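(* Let $\mathcal C$ be a cofibration category. Then the category $f\mathcal C$ of frames in $\mathcal C$ forms a cofibration category with respect to cofibrations and level equivalences. The functor $f\mathcal C\to\mathcal C$ that evaluates in dimension $0$ (i.e. $A\mapsto A^0$) is exact and its derived functor is an equivalence of categories from $\mathbf{Ho}(f\mathcal C)$ to $\mathbf{Ho}(\mathcal C)$.
   Context: **Cofibration categories.** A cofibration category is a category $\mathcal C$ with two classes of morphisms, cofibrations and weak equivalences, such that: (C1) all isomorphisms are cofibrations and weak equivalences; cofibrations are stable under composition; $\mathcal C$ has an initial object and every morphism from an initial object is a cofibration; (C2) if two of $f,g,gf$ are weak equivalences, so is the third; (C3) for a cofibration $i:A\to B$ and any morphism $f:A\to C$ there is a pushout $P$ of $B\xleftarrow{i}A\xrightarrow{f}C$, the morphism $j:C\to P$ is a cofibration, and $j$ is a weak equivalence if $i$ is; (C4) every morphism factors as a cofibration followed by a weak equivalence. The homotopy category $\gamma:\mathcal C\to\mathbf{Ho}(\mathcal C)$ is the localization of $\mathcal C$ at the weak equivalences, taken to be the identity on objects (it exists after possibly passing to a larger universe). A functor $F:\mathcal C\to\mathcal D$ between cofibration categories is exact if it preserves initial objects, cofibrations, weak equivalences and the pushouts along cofibrations guaranteed by (C3); its derived functor is the unique functor $\mathbf{Ho}(F):\mathbf{Ho}(\mathcal C)\to\mathbf{Ho}(\mathcal D)$ with $\mathbf{Ho}(F)\circ\gamma=\gamma\circ F$. **Co-$\Delta$-objects and frames.** $\Delta$ is the category of the ordered sets $[n]=\{0<\dots<n\}$, $n\ge0$,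 and injective monotone maps. A $\Delta$-set is a contravariant functor from $\Delta$ to sets; $\Delta[n]=\Delta(-,[n])$ and $\partial\Delta[n]=\Delta[n]-\{\mathrm{Id}_{[n]}\}$. A co-$\Delta$-object in $\mathcal C$ is a covariant functor $A:\Delta\to\mathcal C$, $A^n=A([n])$; morphisms are natural transformations. For a co-$\Delta$-object $A$ and an object $Z$, $\mathcal C(A,Z)$ is the $\Delta$-set $[n]\mapsto\mathcal C(A^n,Z)$. For a $\Delta$-set $K$, $K\cap A$ denotes a representing object (if it exists) of the functor $Z\mapsto\Delta\text{-set}(K,\mathcal C(A,Z))$; one takes $\Delta[n]\cap A=A^n$. The $n$-th latching object is $\partial^nA=\partial\Delta[n]\cap A$. $A$ is cofibrant if for every $n\ge0$ the latching object $\partial^nA$ exists and the canonical morphism $\nu^n:\partial^nA\to A^n$ is a cofibration. A morphism $f:A\to B$ of cofibrant co-$\Delta$-objects is a cofibration if for every $n\ge0$ the morphism $f^n\cup\nu^n:A^n\cup_{\partial^nA}\partial^nB\to B^n$ is a cofibration in $\mathcal C$. A morphism $f$ of co-$\Delta$-objects is a level equivalence if every $f^n$ is a weak equivalence. A frame is a cofibrant co-$\Delta$-object $A$ that is homotopically constant: for every $\alpha:[n]\to[m]$ in $\Delta$ the morphism $\alpha_*:A^n\to A^m$ is a weak equivalence. $f\mathcal C$ is the full subcategory of co-$\Delta$-objects consisting of frames; its weak equivalences are the level equivalences. *)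

(* Defs.v *)
From mathcomp Require Import all_boot.
From mathcomp Require Import boolp.

Set Implicit Arguments.
Unset Strict Implicit.
Unset Printing Implicit Defensive.

#[local] Obligation Tactic := idtac.
Declare Scope cat_scope.
Delimit Scope cat_scope with cat.
Local Open Scope cat_scope.

(* Size: Loc below, whose morphisms are zigzags, is again a Category, so morphisms
   live in a universe at least as large as that of the objects; a locally small
   category is viewed in such a universe by cumulativity. *)
Record Category := MkCategory {
  Ob :> Type;
  Hom : Ob -> Ob -> Type;
  idm : forall A, Hom A A;
  comp : forall A B C, Hom B C -> Hom A B -> Hom A C;
  compA : forall A B C D (h : Hom C D) (g : Hom B C) (f : Hom A B),
    comp h (comp g f) = comp (comp h g) f;
  comp1m : forall A B (f : Hom A B), comp (idm B) f = f;
  compm1 : forall A B (f : Hom A B), comp f (idm A) = f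
}.
Arguments Hom {c} A B.
Arguments idm {c} A.
Arguments comp {c A B C} g f.

Notation "g ∘ f" := (comp g f) (at level 40, left associativity) : cat_scope.

Record Functor (C D : Category) := MkFunctor {
  fob :> C -> D;
  fhom : forall A B : C, Hom A B -> Hom (fob A) (fob B);
  fhom1 : forall A : C, fhom (idm A) = idm (fob A);
  fhomM : forall (A B B' : C) (g : Hom B B') (f : Hom A B),
    fhom (g ∘ f) = fhom g ∘ fhom f
}.
Arguments fhom {C D} F {A B} f : rename.

Lemma functor_eq (C D : Category) (o : C -> D)
    (h h' : forall A B : C, Hom A B -> Hom (o A) (o B)) h1 hM h1' hM' :
  (forall A B (f : Hom A B), h A B f = h' A B f) ->
  @MkFunctor C D o h h1 hM = @MkFunctor C D o h' h1' hM'.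
Proof.
move=> hh'; have e : h = h'.
  by apply: functional_extensionality_dep => A;
     apply: functional_extensionality_dep => B; apply: funext => f.
by case: _ / e h1' hM' => h1' hM'; congr MkFunctor; apply: Prop_irrelevance.
Qed.

Definition idF (C : Category) : Functor C C :=
  @MkFunctor C C id (fun A B f => f) (fun A => erefl) (fun A B B' g f => erefl).

Program Definition compF (C D E : Category) (G : Functor D E) (F : Functor C D)
  : Functor C E :=
  @MkFunctor C E (fun A => G (F A)) (fun A B f => fhom G (fhom F f)) _ _.
Next Obligation. by move=> * /=; rewrite !fhom1. Qed.
Next Obligation. by move=> * /=; rewrite !fhomM. Qed.

Record NatTrans (C D : Category) (F G : Functor C D) := MkNatTrans {
  nt :> forall A : C, Hom (F A) (G A);
  nt_nat : forall (A B : C) (f : Hom A B), nt B ∘ fhom F f = fhom G f ∘ nt A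
}.

Lemma nt_eq (C D : Category) (F G : Functor C D) (s t : NatTrans F G) :
  (forall A, s A = t A) -> s = t.
Proof.
case: s t => [s hs] [t ht] /= st.
have e : s = t by apply: functional_extensionality_dep.
by case: _ / e ht => ht; congr MkNatTrans; apply: Prop_irrelevance.
Qed.

Program Definition idN (C D : Category) (F : Functor C D) : NatTrans F F :=
  @MkNatTrans C D F F (fun A => idm (F A)) _.
Next Obligation. by move=> * /=; rewrite comp1m compm1. Qed.

Program Definition compN (C D : Category) (F G H : Functor C D)
    (t : NatTrans G H) (s : NatTrans F G) : NatTrans F H :=
  @MkNatTrans C D F H (fun A => t A ∘ s A) _.
Next Obligation. by move=> * /=; rewrite -compA nt_nat !compA nt_nat. Qed.

Program Definition FunCat (C D : Category) : Category :=
  @MkCategory (Functor C D) (@NatTrans C D) (@idN C D) (@compN C D) _ _ _.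
Next Obligation. by move=> *; apply: nt_eq => X /=; rewrite compA. Qed.
Next Obligation. by move=> *; apply: nt_eq => X /=; rewrite comp1m. Qed.
Next Obligation. by move=> *; apply: nt_eq => X /=; rewrite compm1. Qed.

Definition full_sub (C : Category) (P : C -> Prop) : Category :=
  @MkCategory {A : C | P A} (fun A B => Hom (sval A) (sval B))
    (fun A => idm (sval A)) (fun A B B' g f => g ∘ f)
    (fun A B B' B'' h g f => compA h g f)
    (fun A B f => comp1m f) (fun A B f => compm1 f).

Definition is_iso (C : Category) (A B : C) (f : Hom A B) : Prop :=
  exists g : Hom B A, g ∘ f = idm A /\ f ∘ g = idm B.

Definition naturally_iso (C D : Category) (F G : Functor C D) : Prop :=
  exists t : NatTrans F G, forall A, is_iso (t A).

Definition is_equivalence (C D : Category) (F : Functor C D) : Prop :=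
  exists G : Functor D C,
    naturally_iso (compF G F) (idF C) /\ naturally_iso (compF F G) (idF D).

Definition is_initial (C : Category) (I : C) : Prop :=
  forall A : C, exists! f : Hom I A, True.

(* The square  A --i--> B
               |f       |k
               C --j--> P   *)
Definition is_pushout (T : Category) (A B C P : T) (i : Hom A B) (f : Hom A C)
    (k : Hom B P) (j : Hom C P) : Prop :=
  k ∘ i = j ∘ f /\
  forall (Z : T) (b : Hom B Z) (c : Hom C Z), b ∘ i = c ∘ f ->
    exists! h : Hom P Z, h ∘ k = b /\ h ∘ j = c.

Record PreCofCat := MkPreCofCat {
  pcat :> Category;
  cof : forall A B : pcat, Hom A B -> Prop;
  weq : forall A B : pcat, Hom A B -> Prop
}.
Arguments cof {p A B} f.
Arguments weq {p A B} f.

Record is_cofibration_category (C : PreCofCat) : Prop := {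
  iso_cof : forall (A B : C) (f : Hom A B), is_iso f -> cof f;
  iso_weq : forall (A B : C) (f : Hom A B), is_iso f -> weq f;
  cof_comp : forall (A B B' : C) (g : Hom B B') (f : Hom A B),
    cof g -> cof f -> cof (g ∘ f);
  has_initial : exists I : C, is_initial I;
  initial_cof : forall (I A : C) (f : Hom I A), is_initial I -> cof f;
  weq_comp : forall (A B B' : C) (g : Hom B B') (f : Hom A B),
    weq f -> weq g -> weq (g ∘ f);
  weq_cancel_right : forall (A B B' : C) (g : Hom B B') (f : Hom A B),
    weq f -> weq (g ∘ f) -> weq g;
  weq_cancel_left : forall (A B B' : C) (g : Hom B B') (f : Hom A B),
    weq g -> weq (g ∘ f) -> weq f;
  cof_pushout : forall (A B B' : C) (i : Hom A B) (f : Hom A B'), cof i ->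
    exists (P : C) (k : Hom B P) (j : Hom B' P),
      [/\ is_pushout i f k j, cof j & weq i -> weq j];
  factorization : forall (A B : C) (f : Hom A B),
    exists (M : C) (i : Hom A M) (p : Hom M B), [/\ cof i, weq p & f = p ∘ i]
}.

Record is_exact (C D : PreCofCat) (F : Functor C D) : Prop := {
  exact_initial : forall I : C, is_initial I -> is_initial (F I);
  exact_cof : forall (A B : C) (f : Hom A B), cof f -> cof (fhom F f);
  exact_weq : forall (A B : C) (f : Hom A B), weq f -> weq (fhom F f);
  exact_pushout : forall (A B B' P : C) (i : Hom A B) (f : Hom A B')
      (k : Hom B P) (j : Hom B' P), cof i -> is_pushout i f k j ->
    is_pushout (fhom F i) (fhom F f) (fhom F k) (fhom F j)
}.

Section Localization.
Variable C : Category.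
Variable W : forall A B : C, Hom A B -> Prop.

Definition inverts (D : Category) (F : Functor C D) : Prop :=
  forall (A B : C) (f : Hom A B), W f -> is_iso (fhom F f).

Definition is_localization (H : Category) (g : Functor C H) : Prop :=
  inverts g /\
  forall (D : Category) (F : Functor C D), inverts F ->
    exists! G : Functor H D, compF G g = F.

(* Zigzags from A, read from the last arrow backwards. *)
Inductive zigzag (A : C) : C -> Type :=
| zz_id : zigzag A A
| zz_fwd B B' : Hom B B' -> zigzag A B -> zigzag A B'
| zz_bwd B B' (w : Hom B' B) : W w -> zigzag A B -> zigzag A B'.

Fixpoint zz_comp (A B B' : C) (q : zigzag B B') (p : zigzag A B) : zigzag A B' :=
  match q in zigzag _ X return zigzag A X with
  | zz_id => p
  | zz_fwd _ _ f q => zz_fwd f (zz_comp q p)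
  | zz_bwd _ _ _ hw q => zz_bwd hw (zz_comp q p)
  end.

Inductive zz_rel (A : C) : forall B : C, zigzag A B -> zigzag A B -> Prop :=
| zz_refl B (p : zigzag A B) : zz_rel p p
| zz_sym B (p q : zigzag A B) : zz_rel p q -> zz_rel q p
| zz_trans B (p q r : zigzag A B) : zz_rel p q -> zz_rel q r -> zz_rel p r
| zz_cong_fwd B B' (f : Hom B B') p q :
    zz_rel p q -> zz_rel (zz_fwd f p) (zz_fwd f q)
| zz_cong_bwd B B' (w : Hom B' B) (hw : W w) p q :
    zz_rel p q -> zz_rel (zz_bwd hw p) (zz_bwd hw q)
| zz_fwd_id B (p : zigzag A B) : zz_rel (zz_fwd (idm B) p) p
| zz_fwd_comp B B' B'' (g : Hom B' B'') (f : Hom B B') p :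
    zz_rel (zz_fwd g (zz_fwd f p)) (zz_fwd (g ∘ f) p)
| zz_bwd_fwd B B' (w : Hom B B') (hw : W w) p :
    zz_rel (zz_bwd hw (zz_fwd w p)) p
| zz_fwd_bwd B B' (w : Hom B B') (hw : W w) p :
    zz_rel (zz_fwd w (zz_bwd hw p)) p.

Definition loc_hom (A B : C) : Type :=
  {c : zigzag A B -> Prop | exists p, c = zz_rel p}.

Definition zz_class (A B : C) (p : zigzag A B) : loc_hom A B :=
  exist _ (zz_rel p) (ex_intro _ p erefl).

Definition zz_repr (A B : C) (c : loc_hom A B) : zigzag A B :=
  sval (cid (svalP c)).

Lemma zz_reprK (A B : C) (c : loc_hom A B) : zz_class (zz_repr c) = c.
Proof.
rewrite /zz_repr; case: cid => p /= e; case: c e => c hc /= e.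
by apply: eq_exist; rewrite e.
Qed.

Lemma zz_classP (A B : C) (p q : zigzag A B) :
  zz_class p = zz_class q <-> zz_rel p q.
Proof.
split=> [/(congr1 sval) /= e | pq].
  by rewrite e; apply: zz_refl.
apply: eq_exist; apply/funext => r; apply/propext; split=> h.
  by apply: zz_trans h; apply: zz_sym.
by apply: zz_trans h.
Qed.

Lemma zz_repr_class (A B : C) (p : zigzag A B) : zz_rel (zz_repr (zz_class p)) p.
Proof. by apply/zz_classP; rewrite zz_reprK. Qed.

Lemma zz_comp_rel (A B B' : C) (q q' : zigzag B B') (p p' : zigzag A B) :
  zz_rel q q' -> zz_rel p p' -> zz_rel (zz_comp q p) (zz_comp q' p').
Proof.
move=> qq' pp'; apply: (@zz_trans _ _ _ (zz_comp q p')).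
  by elim: q {qq'} => //= *; [apply: zz_cong_fwd | apply: zz_cong_bwd].
elim: qq' => {q q' B'} /= *; first exact: zz_refl.
- exact: zz_sym.
- by apply: zz_trans; eassumption.
- exact: zz_cong_fwd.
- exact: zz_cong_bwd.
- exact: zz_fwd_id.
- exact: zz_fwd_comp.
- exact: zz_bwd_fwd.
- exact: zz_fwd_bwd.
Qed.

Lemma zz_compA (A B B' B'' : C) (r : zigzag B' B'') (q : zigzag B B')
    (p : zigzag A B) : zz_comp r (zz_comp q p) = zz_comp (zz_comp r q) p.
Proof. by elim: r => //= [? ? ? ? -> | ? ? ? ? ? ->]. Qed.

Lemma zz_compm1 (A B : C) (p : zigzag A B) : zz_comp p (zz_id A) = p.
Proof. by elim: p => //= [? ? ? ? -> | ? ? ? ? ? ->]. Qed.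

Definition loc_comp (A B B' : C) (d : loc_hom B B') (c : loc_hom A B) :
    loc_hom A B' :=
  zz_class (zz_comp (zz_repr d) (zz_repr c)).

Lemma loc_compE (A B B' : C) (q : zigzag B B') (p : zigzag A B) :
  loc_comp (zz_class q) (zz_class p) = zz_class (zz_comp q p).
Proof. by apply/zz_classP/zz_comp_rel; apply: zz_repr_class. Qed.

Program Definition Loc : Category :=
  @MkCategory C loc_hom (fun A => zz_class (zz_id A)) loc_comp _ _ _.
Next Obligation.
move=> A B B' B'' h g f; rewrite -[h]zz_reprK -[g]zz_reprK -[f]zz_reprK.
by rewrite !loc_compE zz_compA.
Qed.
Next Obligation. by move=> A B f; rewrite -[f]zz_reprK loc_compE. Qed.
Next Obligation. by move=> A B f; rewrite -[f]zz_reprK loc_compE zz_compm1. Qed.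

Program Definition loc_functor : Functor C Loc :=
  @MkFunctor C Loc id (fun A B f => zz_class (zz_fwd f (zz_id A))) _ _.
Next Obligation. by move=> A; apply/zz_classP/zz_fwd_id. Qed.
Next Obligation.
move=> A B B' g f; rewrite /= loc_compE; apply/zz_classP/zz_sym.
exact: zz_fwd_comp.
Qed.

Lemma loc_functor_bwd (A B : C) (w : Hom A B) (hw : W w) :
  (zz_class (zz_bwd hw (zz_id B)) : @Hom Loc B A) ∘ fhom loc_functor w
    = idm (loc_functor A) /\
  fhom loc_functor w ∘ (zz_class (zz_bwd hw (zz_id B)) : @Hom Loc B A)
    = idm (loc_functor B).
Proof.
rewrite /= !loc_compE; split; apply/zz_classP => /=.
  exact: zz_bwd_fwd.
exact: zz_fwd_bwd.
Qed.

Lemma loc_functor_inverts : inverts loc_functor.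
Proof.
move=> A B w hw; exists (zz_class (zz_bwd hw (zz_id B))).
exact: loc_functor_bwd.
Qed.

Section Extension.
Variables (D : Category) (F : Functor C D) (hF : inverts F).

Definition loc_inv (A B : C) (w : Hom A B) (hw : W w) : Hom (F B) (F A) :=
  sval (cid (hF hw)).

Lemma loc_invP (A B : C) (w : Hom A B) (hw : W w) :
  loc_inv hw ∘ fhom F w = idm (F A) /\ fhom F w ∘ loc_inv hw = idm (F B).
Proof. by rewrite /loc_inv; case: cid. Qed.

Fixpoint zz_eval (A B : C) (p : zigzag A B) : Hom (F A) (F B) :=
  match p in zigzag _ X return Hom (F A) (F X) with
  | zz_id => idm (F A)
  | zz_fwd _ _ f p => fhom F f ∘ zz_eval p
  | zz_bwd _ _ _ hw p => loc_inv hw ∘ zz_eval p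
  end.

Lemma zz_eval_rel (A B : C) (p q : zigzag A B) :
  zz_rel p q -> zz_eval p = zz_eval q.
Proof.
elim=> {B p q} //=.
- by move=> B p q r _ -> _ ->.
- by move=> B B' f p q _ ->.
- by move=> B B' w hw p q _ ->.
- by move=> B p; rewrite fhom1 comp1m.
- by move=> B B' B'' g f p; rewrite fhomM compA.
- by move=> B B' w hw p; rewrite compA (loc_invP hw).1 comp1m.
- by move=> B B' w hw p; rewrite compA (loc_invP hw).2 comp1m.
Qed.

Lemma zz_eval_comp (A B B' : C) (q : zigzag B B') (p : zigzag A B) :
  zz_eval (zz_comp q p) = zz_eval q ∘ zz_eval p.
Proof.
elim: q => /= [|? ? ? ? ->|? ? ? ? ? ->]; by rewrite ?comp1m ?compA.
Qed.

Program Definition loc_ext : Functor Loc D :=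
  @MkFunctor Loc D F (fun A B c => zz_eval (zz_repr c)) _ _.
Next Obligation. by move=> A /=; rewrite (zz_eval_rel (zz_repr_class _)). Qed.
Next Obligation.
by move=> A B B' g f /=; rewrite (zz_eval_rel (zz_repr_class _)) zz_eval_comp.
Qed.

Lemma loc_extE : compF loc_ext loc_functor = F.
Proof.
rewrite [RHS](_ : F = @MkFunctor C D F (@fhom _ _ F) (@fhom1 _ _ F) (@fhomM _ _ F));
  last by case: (F).
apply: functor_eq => A B f /=.
by rewrite (zz_eval_rel (zz_repr_class _)) /= compm1.
Qed.

End Extension.

Lemma inv_unique (D : Category) (A B : D) (f : Hom A B) (g g' : Hom B A) :
  g ∘ f = idm A -> f ∘ g' = idm B -> g = g'.
Proof. by move=> gf fg'; rewrite -[g]compm1 -fg' compA gf comp1m. Qed.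

Lemma loc_ext_unique (D : Category) (G G' : Functor Loc D) :
  compF G loc_functor = compF G' loc_functor -> G = G'.
Proof.
case: G G' => [o h h1 hM] [o' h' h1' hM'] e.
have eo : o = o' by have := congr1 (@fob _ _) e.
case: _ / eo h' h1' hM' e => h' h1' hM' e.
pose arrow (F : Functor C D) (A B : C) (f : Hom A B) :
  {o : C -> D & Hom (o A) (o B)} := existT _ (fob F) (fhom F f).
have hg A B (f : Hom A B) :
    h _ _ (fhom loc_functor f) = h' _ _ (fhom loc_functor f).
  have := congr1 (fun F => arrow F A B f) e; rewrite /arrow /= => ea.
  have := projT2_eq ea; rewrite (Prop_irrelevance (projT1_eq ea) erefl) /=.
  by [].
apply: functor_eq => A B c; rewrite -[c]zz_reprK.
elim: (zz_repr c) => {B c} [|B B' f p IH|B B' w hw p IH].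
- by rewrite (h1 A : _ = _) (h1' A : _ = _).
- have -> : zz_class (zz_fwd f p) = (fhom loc_functor f : @Hom Loc B B') ∘ zz_class p.
    by rewrite /= loc_compE.
  by rewrite hM hM' IH hg.
- pose v : @Hom Loc B B' := zz_class (zz_bwd hw (zz_id B)).
  have -> : zz_class (zz_bwd hw p) = v ∘ (zz_class p : @Hom Loc A B).
    by rewrite /v /= loc_compE.
  rewrite hM hM' IH; congr (_ ∘ _).
  have [vw wv] := loc_functor_bwd hw.
  apply: (@inv_unique _ _ _ (h _ _ (fhom loc_functor w))).
    by rewrite -hM vw h1.
  by rewrite hg -hM' wv h1'.
Qed.

Lemma loc_functorP : is_localization loc_functor.
Proof.
split=> [|D F hF]; first exact: loc_functor_inverts.
exists (loc_ext hF); split=> [|G e]; first exact: loc_extE.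
by apply: loc_ext_unique; rewrite loc_extE e.
Qed.

End Localization.

Definition Ho (C : PreCofCat) : Category := Loc (@weq C).

Definition gamma (C : PreCofCat) : Functor C (Ho C) := loc_functor (@weq C).

Lemma exact_gamma_inverts (C D : PreCofCat) (F : Functor C D) :
  is_exact F -> inverts (@weq C) (compF (gamma D) F).
Proof. by move=> hF A B f /(exact_weq hF); apply: loc_functor_inverts. Qed.

Definition derived_functor (C D : PreCofCat) (F : Functor C D)
    (hF : is_exact F) : Functor (Ho C) (Ho D) :=
  loc_ext (exact_gamma_inverts hF).

Lemma derived_functorE (C D : PreCofCat) (F : Functor C D) (hF : is_exact F) :
  compF (derived_functor hF) (gamma C) = compF (gamma D) F.
Proof. exact: loc_extE. Qed.

Lemma derived_functor_unique (C D : PreCofCat) (F : Functor C D)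
    (hF : is_exact F) (G : Functor (Ho C) (Ho D)) :
  compF G (gamma C) = compF (gamma D) F -> G = derived_functor hF.
Proof. by move=> e; apply: loc_ext_unique; rewrite e; apply/esym/loc_extE. Qed.

(* The object [n] is represented by n, its underlying set by 'I_n.+1. *)
Definition inj_mono (n m : nat) (f : {ffun 'I_n.+1 -> 'I_m.+1}) : bool :=
  injectiveb f && [forall i : 'I_n.+1, forall j : 'I_n.+1, (i <= j) ==> (f i <= f j)].

Lemma inj_monoP (n m : nat) (f : {ffun 'I_n.+1 -> 'I_m.+1}) :
  reflect (injective f /\ {homo f : i j / i <= j}) (inj_mono f).
Proof.
apply: (iffP andP) => [[/injectiveP injf /forallP h]|[injf h]]; split => //.
- by move=> i j ij; have /forallP/(_ j)/implyP := h i; apply.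
- exact/injectiveP.
- by apply/forallP => i; apply/forallP => j; apply/implyP; apply: h.
Qed.

Definition Delta_hom (n m : nat) : Type :=
  {f : {ffun 'I_n.+1 -> 'I_m.+1} | inj_mono f}.

Lemma Delta_id_subproof (n : nat) : inj_mono [ffun i : 'I_n.+1 => i].
Proof.
by apply/inj_monoP; split=> [i j|i j]; rewrite !ffunE.
Qed.

Lemma Delta_comp_subproof (n m p : nat) (g : Delta_hom m p) (f : Delta_hom n m) :
  inj_mono [ffun i => val g (val f i)].
Proof.
case: f g => [f /= /inj_monoP[injf hf]] [g /= /inj_monoP[injg hg]].
apply/inj_monoP; split=> i j; rewrite !ffunE; first by move/injg/injf.
by move=> ij; apply/hg/hf.
Qed.

Program Definition Delta : Category :=
  @MkCategory nat Delta_hom (fun n => exist _ _ (Delta_id_subproof n))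
    (fun n m p g f => exist _ _ (Delta_comp_subproof g f)) _ _ _.
Next Obligation. by move=> *; apply/val_inj/ffunP => i; rewrite !ffunE. Qed.
Next Obligation. by move=> *; apply/val_inj/ffunP => i; rewrite !ffunE. Qed.
Next Obligation. by move=> *; apply/val_inj/ffunP => i; rewrite !ffunE. Qed.

Record DeltaSet := MkDeltaSet {
  cells :> nat -> Type;
  face : forall n m : nat, @Hom Delta n m -> cells m -> cells n;
  face1 : forall n (x : cells n), face (idm (n : Delta)) x = x;
  faceM : forall (n m p : nat) (b : @Hom Delta m p) (a : @Hom Delta n m) x,
    face (b ∘ a) x = face a (face b x)
}.
Arguments face K {n m} a x : rename.

Record DeltaMap (K L : DeltaSet) := MkDeltaMap {
  dmap :> forall n, K n -> L n;
  dmap_nat : forall (n m : nat) (a : @Hom Delta n m) (x : K m),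
    dmap (face K a x) = face L a (dmap x)
}.

Lemma dmap_eq (K L : DeltaSet) (s t : DeltaMap K L) :
  (forall n (x : K n), s n x = t n x) -> s = t.
Proof.
case: s t => [s hs] [t ht] /= e.
have {}e : s = t by apply: functional_extensionality_dep => n; apply: funext.
by case: _ / e ht => ht; congr MkDeltaMap; apply: Prop_irrelevance.
Qed.

Program Definition compD (K L M : DeltaSet) (t : DeltaMap L M)
    (s : DeltaMap K L) : DeltaMap K M :=
  @MkDeltaMap K M (fun n x => t n (s n x)) _.
Next Obligation. by move=> * /=; rewrite !dmap_nat. Qed.

Definition simplex (n : nat) : DeltaSet :=
  @MkDeltaSet (fun k => @Hom Delta k n) (fun k l a x => x ∘ a)
    (fun k x => compm1 x) (fun k l p b a x => compA x b a).

(* The arrow x : [k] -> [n] is the identity of [n]; the equality is one of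
   dependent pairs since k and n need not be the same term. *)
Definition is_idm (C : Category) (A B : C) (x : Hom A B) : Prop :=
  existT (fun X => Hom X B) A x = existT (fun X => Hom X B) B (idm B).

Lemma Delta_hom_leq (n m : nat) (f : @Hom Delta n m) : n <= m.
Proof.
case: f => f /= /inj_monoP[injf _].
by have := leq_card f injf; rewrite !card_ord.
Qed.

Lemma Delta_endo (n : nat) (f : @Hom Delta n n) : f = idm (n : Delta).
Proof.
case: f => f hf; apply: val_inj => /=; apply/ffunP => i; rewrite ffunE.
have /inj_monoP[injf mf] := hf.
have sf (a b : 'I_n.+1) : a < b -> f a < f b.
  move=> ab; rewrite ltn_neqAle mf 1?ltnW // andbT.
  by apply: contraTneq ab => /val_inj/injf ->; rewrite ltnn.
apply/ord_inj/eqP; rewrite eqn_leq; apply/andP; split.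
  have [k] := ubnP (n - i); elim: k i => // k IH i.
  rewrite ltnS => hk; have := ltn_ord i; rewrite ltnS leq_eqVlt.
  case/orP => [/eqP e|lt_in]; first by rewrite e -ltnS.
  have hi : i.+1 < n.+1 by [].
  rewrite -ltnS; apply: leq_trans (sf i (Ordinal hi) _) _ => //.
  by apply: (IH (Ordinal hi)); rewrite /= subnS prednK ?subn_gt0.
case: i; elim=> // k IH hk; have hk' := ltnW hk.
exact: leq_ltn_trans (IH hk') (sf (Ordinal hk') (Ordinal hk) _).
Qed.

Lemma Delta_is_idmE (k n : nat) (x : @Hom Delta k n) : is_idm x <-> k = n.
Proof.
split=> [/(congr1 (@projT1 _ _)) //|e].
by move: x; rewrite e => x; rewrite (Delta_endo x).
Qed.

Lemma boundary_subproof (n k l : nat) (a : @Hom Delta k l) (x : @Hom Delta l n) :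
  ~ is_idm x -> ~ is_idm (x ∘ a).
Proof.
move=> hx /Delta_is_idmE e; apply/hx/Delta_is_idmE/eqP.
by rewrite eqn_leq (Delta_hom_leq x) -e (Delta_hom_leq a).
Qed.

Program Definition boundary (n : nat) : DeltaSet :=
  @MkDeltaSet (fun k => {x : @Hom Delta k n | ~ is_idm x})
    (fun k l a x => exist _ (sval x ∘ a) (boundary_subproof (svalP x))) _ _.
Next Obligation. by move=> n k [x hx]; apply: eq_exist; exact: (compm1 x). Qed.
Next Obligation. by move=> n k l p b a [x hx]; apply: eq_exist; exact: (compA x b a). Qed.

Definition boundary_incl (n : nat) : DeltaMap (boundary n) (simplex n) :=
  @MkDeltaMap (boundary n) (simplex n) (fun k x => sval x)
    (fun k l a x => erefl).

Definition coDelta (C : Category) : Category := FunCat Delta C.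

Section CoDelta.
Variable C : Category.

Program Definition map_set (A : coDelta C) (Z : C) : DeltaSet :=
  @MkDeltaSet (fun n => Hom (A n) Z) (fun n m a x => x ∘ fhom A a) _ _.
Next Obligation. by move=> * /=; rewrite fhom1 compm1. Qed.
Next Obligation. by move=> * /=; rewrite fhomM compA. Qed.

Program Definition map_set_post (A : coDelta C) (Z Z' : C) (g : Hom Z Z') :
    DeltaMap (map_set A Z) (map_set A Z') :=
  @MkDeltaMap (map_set A Z) (map_set A Z') (fun n x => g ∘ x) _.
Next Obligation. by move=> * /=; rewrite compA. Qed.

Program Definition map_set_pre (A B : coDelta C) (f : Hom A B) (Z : C) :
    DeltaMap (map_set B Z) (map_set A Z) :=
  @MkDeltaMap (map_set B Z) (map_set A Z) (fun n x => x ∘ f n) _.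
Next Obligation. by move=> * /=; rewrite -!compA nt_nat. Qed.

(* A choice of K ∩ A: an object representing Z |-> DeltaMap K (map_set A Z). *)
Record representation (K : DeltaSet) (A : coDelta C) := MkRepresentation {
  rep_ob :> C;
  rep_to : forall Z : C, Hom rep_ob Z -> DeltaMap K (map_set A Z);
  rep_of : forall Z : C, DeltaMap K (map_set A Z) -> Hom rep_ob Z;
  rep_toK : forall Z : C, cancel (@rep_to Z) (@rep_of Z);
  rep_ofK : forall Z : C, cancel (@rep_of Z) (@rep_to Z);
  rep_to_nat : forall (Z Z' : C) (g : Hom Z Z') (x : Hom rep_ob Z),
    rep_to (g ∘ x) = compD (map_set_post A g) (rep_to x)
}.

Definition rep_univ (K : DeltaSet) (A : coDelta C) (P : representation K A) :
    DeltaMap K (map_set A P) :=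
  rep_to (idm (rep_ob P)).

(* The morphism i ∩ f : K ∩ A -> L ∩ B. *)
Definition rep_mor (K L : DeltaSet) (A B : coDelta C) (i : DeltaMap K L)
    (f : Hom A B) (P : representation K A) (Q : representation L B) :
    Hom (rep_ob P) (rep_ob Q) :=
  rep_of P (compD (map_set_pre f Q) (compD (rep_univ Q) i)).

Definition idD (K : DeltaSet) : DeltaMap K K :=
  @MkDeltaMap K K (fun n x => x) (fun n m a x => erefl).

(* simplex n ∩ A = A^n, by the Yoneda lemma. *)
Program Definition simplex_rep (n : nat) (A : coDelta C) :
    representation (simplex n) A :=
  @MkRepresentation (simplex n) A (A n)
    (fun Z x => @MkDeltaMap (simplex n) (map_set A Z)
                  (fun k a => x ∘ fhom A a) _)
    (fun Z t => t n (idm (n : Delta))) _ _ _.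
Next Obligation. by move=> n A Z x k l a y; rewrite /= fhomM compA. Qed.
Next Obligation. by move=> n A Z x /=; rewrite fhom1 compm1. Qed.
Next Obligation.
move=> n A Z t; apply: dmap_eq => k x /=.
rewrite -[in RHS](comp1m x); exact/esym/(dmap_nat t x (idm (n : Delta))).
Qed.
Next Obligation. by move=> n A Z Z' g x; apply: dmap_eq => k y /=; rewrite compA. Qed.

Definition latching (n : nat) (A : coDelta C) : Type :=
  representation (boundary n) A.

Definition latching_map (n : nat) (A : coDelta C) (P : latching n A) :
    Hom (rep_ob P) (A n) :=
  rep_mor (boundary_incl n) (idm A) P (simplex_rep n A).

Definition latching_mor (n : nat) (A B : coDelta C) (f : Hom A B)
    (P : latching n A) (Q : latching n B) : Hom (rep_ob P) (rep_ob Q) :=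
  rep_mor (idD (boundary n)) f P Q.

End CoDelta.

Section Frames.
Variable C : PreCofCat.

(* In the next two definitions the latching objects and the pushout are unique
   up to isomorphism, so the particular choice is irrelevant. *)
Definition cofibrant (A : coDelta C) : Prop :=
  forall n : nat, exists P : latching n A, cof (latching_map P).

Definition is_cofibration (A B : coDelta C) (f : Hom A B) : Prop :=
  forall n : nat,
    exists (P : latching n A) (Q : latching n B) (R : C)
           (a : Hom (A n) R) (b : Hom (rep_ob Q) R) (h : Hom R (B n)),
      [/\ is_pushout (latching_map P) (latching_mor f P Q) a b,
          h ∘ a = f n, h ∘ b = latching_map Q & cof h].

Definition level_equivalence (A B : coDelta C) (f : Hom A B) : Prop :=
  forall n : nat, weq (f n).

Definition homotopically_constant (A : coDelta C) : Prop :=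
  forall (n m : nat) (a : @Hom Delta n m), weq (fhom A a).

Definition is_frame (A : coDelta C) : Prop :=
  cofibrant A /\ homotopically_constant A.

Definition frames : PreCofCat :=
  @MkPreCofCat (full_sub is_frame)
    (fun A B f => is_cofibration f) (fun A B f => level_equivalence f).

Definition eval0 : Functor frames C :=
  @MkFunctor frames C (fun A => fob (sval A) 0) (fun A B f => nt f 0)
    (fun A => erefl) (fun A B B' g f => erefl).

End Frames.

(* Main.v *)
From mathcomp Require Import all_boot.
From mathcomp Require Import boolp.
Require Import Defs.

Set Implicit Arguments.
Unset Strict Implicit.
Unset Printing Implicit Defensive.

#[local] Obligation Tactic := idtac.
Local Open Scope cat_scope.

(* Latching objects are built cell by cell, which gives the usual Reedy calculus: a
   cofibration is a cofibration in every degree, pushouts are computed degreewise, and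
   every map from a cofibrant [A] to an arbitrary co-Delta-object [M] factors as a
   cofibration followed by a level equivalence. The gluing lemma shows that a pushout
   of frames is homotopically constant.

   For maps [p : A -> M] and [p' : A' -> M] from frames to a homotopically constant
   [M], with [p'] a level equivalence, factoring [A + A' -> M] gives a well-defined
   morphism [p'^-1 p : A -> A'] of Ho(frames), compatible with composition. Choosing
   for every [X] a frame [F X] with a level equivalence to the constant object [cX]
   thus defines a functor F from Ho(C) to Ho(frames). Evaluation in degree 0 recovers
   [X] up to isomorphism, while [F (A^0)] is identified with [A] through the zigzag
   [cA^0 -> Dec A <- A] of level equivalences, where [Dec A] is [A] shifted by
   adjoining a new first vertex. *)

(** * Pushouts and the gluing lemma *)

(** The objects [cX] and [Dec A] are in general not cofibrant, so maps into them are not morphisms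
    of frames and mean nothing directly in the homotopy category. This is why fractions are formed
    over an arbitrary homotopically constant [M] and compared through frames over [M].
    Factorizations in [C] are not functorial, so a frame over [cX] depends functorially on [X] only
    after localization. Since [Delta] has only injections, there is no map from [[n]] to [[0]] for
    [n > 0], and no choice of a vertex is preserved by all arrows; so in general neither [A -> cA^0]
    nor [cA^0 -> A] exists naturally. A new vertex that every arrow fixes supplies such a map after
    one shift. Because [C] is only given pushouts along cofibrations, the existence of latching
    objects and the cofibration property are proved together. The factorization avoids truncated
    objects: each stage is a full co-Delta-object differing from the previous one in a single
    degree, and latching data are moved along maps that are isomorphisms in lower degrees. *)

Section Categories.
Variable T : Category.

Lemma comp_eqr (A B B' D : T) (k : Hom B' D) (g : Hom B B') (f : Hom A B) (h : Hom A B') :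
  g ∘ f = h -> k ∘ g ∘ f = k ∘ h.
Proof. by move=> <-; rewrite compA. Qed.

Lemma comp_eqr2 (A B B' B'' D : T) (k : Hom B' D) (g : Hom B B') (f : Hom A B)
    (g' : Hom B'' B') (f' : Hom A B'') :
  g ∘ f = g' ∘ f' -> k ∘ g ∘ f = k ∘ g' ∘ f'.
Proof. by move=> e; rewrite -!compA e. Qed.

Lemma is_iso_id (A : T) : is_iso (idm A).
Proof. by exists (idm A); rewrite comp1m. Qed.

Lemma is_iso_comp (A B D : T) (g : Hom B D) (f : Hom A B) :
  is_iso g -> is_iso f -> is_iso (g ∘ f).
Proof.
move=> [g' [gg' g'g]] [f' [ff' f'f]]; exists (f' ∘ g').
by rewrite !compA (comp_eqr _ gg') (comp_eqr _ f'f) !compm1.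
Qed.

Lemma is_iso_cancel (A B D : T) (g : Hom B D) (f : Hom A B) :
  is_iso g -> is_iso (g ∘ f) -> is_iso f.
Proof.
move=> [g' [g'g gg']] [h [hgf gfh]]; exists (h ∘ g); split; first by rewrite -compA.
rewrite -[LHS]comp1m -g'g -!compA; congr (g' ∘ _).
by rewrite !compA gfh comp1m.
Qed.

Lemma iso_mono (A B D : T) (g : Hom B D) (f f' : Hom A B) :
  is_iso g -> g ∘ f = g ∘ f' -> f = f'.
Proof. by move=> [h [hg _]] e; rewrite -[f]comp1m -[f']comp1m -hg -!compA e. Qed.

Lemma iso_epi (A B D : T) (g : Hom A B) (f f' : Hom B D) :
  is_iso g -> f ∘ g = f' ∘ g -> f = f'.
Proof. by move=> [h [_ gh]] e; rewrite -[f]compm1 -[f']compm1 -gh !compA e. Qed.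

Lemma initial_ex (I A : T) : is_initial I -> exists f : Hom I A, True.
Proof. by move=> /(_ A) [f _]; exists f. Qed.

Lemma initial_eq (I A : T) (f g : Hom I A) : is_initial I -> f = g.
Proof. by move=> /(_ A) [h [_ hu]]; rewrite -(hu f) // -(hu g). Qed.

Lemma initial_isoP (I J : T) (f : Hom I J) : is_initial I -> is_initial J -> is_iso f.
Proof.
move=> hI hJ; have [g _] := initial_ex I hJ; exists g.
by split; apply: initial_eq.
Qed.

Lemma iso_initial (I J : T) (f : Hom I J) : is_iso f -> is_initial I -> is_initial J.
Proof.
move=> [g [gf fg]] hI A; have [h _] := initial_ex A hI.
exists (h ∘ g); split=> // k _.
by apply: (iso_epi (g := f)); [exists g | apply: initial_eq].
Qed.

Section Pushouts.
Variables (A B D P : T) (i : Hom A B) (f : Hom A D) (k : Hom B P) (j : Hom D P).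
Hypothesis po : is_pushout i f k j.

Lemma po_comm : k ∘ i = j ∘ f. Proof. by case: po. Qed.

Lemma po_ex (Z : T) (b : Hom B Z) (c : Hom D Z) :
  b ∘ i = c ∘ f -> exists h : Hom P Z, h ∘ k = b /\ h ∘ j = c.
Proof. by move=> e; have [h [hh _]] := po.2 Z b c e; exists h. Qed.

Lemma po_eq (Z : T) (h h' : Hom P Z) : h ∘ k = h' ∘ k -> h ∘ j = h' ∘ j -> h = h'.
Proof.
move=> ek ej; have e : h ∘ k ∘ i = h ∘ j ∘ f by rewrite -!compA po_comm.
have [h0 [_ h0u]] := po.2 Z _ _ e.
by rewrite -(h0u h) // -(h0u h').
Qed.

End Pushouts.

Lemma pushoutI (A B D P : T) (i : Hom A B) (f : Hom A D) (k : Hom B P) (j : Hom D P) :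
  k ∘ i = j ∘ f ->
  (forall (Z : T) (b : Hom B Z) (c : Hom D Z), b ∘ i = c ∘ f ->
    exists h : Hom P Z, h ∘ k = b /\ h ∘ j = c) ->
  (forall (Z : T) (h h' : Hom P Z), h ∘ k = h' ∘ k -> h ∘ j = h' ∘ j -> h = h') ->
  is_pushout i f k j.
Proof.
move=> e ex un; split=> // Z b c /ex[h [hk hj]]; exists h; split=> // h' [hk' hj'].
by apply: un; rewrite ?hk ?hj.
Qed.

Lemma pushout_sym (A B D P : T) (i : Hom A B) (f : Hom A D) (k : Hom B P) (j : Hom D P) :
  is_pushout i f k j -> is_pushout f i j k.
Proof.
move=> po; apply: pushoutI => [|Z b c e|Z h h' e e'].
- by rewrite (po_comm po).
- by have [h [hk hj]] := po_ex po (esym e); exists h.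
- exact: (po_eq po).
Qed.

Lemma pushout_paste (A B D P E Q : T) (i : Hom A B) (f : Hom A D) (k : Hom B P)
    (j : Hom D P) (g : Hom D E) (k' : Hom P Q) (j' : Hom E Q) :
  is_pushout i f k j -> is_pushout j g k' j' ->
  is_pushout i (g ∘ f) (k' ∘ k) j'.
Proof.
move=> po po'; apply: pushoutI => [|Z b c|Z h h'].
- by rewrite !compA (comp_eqr2 _ (po_comm po)) (po_comm po').
- rewrite compA => e; have [h [hk hj]] := po_ex po e.
  have [h' [hk' hj']] := po_ex po' hj.
  by exists h'; rewrite compA hk' hk.
- rewrite !compA => ek ej; apply: (po_eq po') => //; apply: (po_eq po) => //.
  by rewrite -!compA (po_comm po') !compA ej.
Qed.

Lemma pushout_cancel (A B D P E Q : T) (i : Hom A B) (f : Hom A D) (k : Hom B P)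
    (j : Hom D P) (g : Hom D E) (k' : Hom P Q) (j' : Hom E Q) :
  is_pushout i f k j -> is_pushout i (g ∘ f) (k' ∘ k) j' -> k' ∘ j = j' ∘ g ->
  is_pushout j g k' j'.
Proof.
move=> po po' e; apply: pushoutI => // [Z b c bc|Z h h' ek ej].
- have e' : b ∘ k ∘ i = c ∘ (g ∘ f) by rewrite compA -bc -!compA (po_comm po).
  have [h [hk hj]] := po_ex po' e'; exists h; split=> //.
  by apply: (po_eq po); rewrite -compA ?hk // e compA hj.
- by apply: (po_eq po') => //; rewrite !compA ek.
Qed.

Lemma pushout_of_isos (A B D P : T) (i : Hom A B) (f : Hom A D) (k : Hom B P)
    (j : Hom D P) : is_iso f -> is_iso k -> k ∘ i = j ∘ f -> is_pushout i f k j.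
Proof.
move=> hf [k' [k'k kk']] e; apply: pushoutI => // [Z b c bc|Z h h' ek ej].
- exists (b ∘ k'); split; first by rewrite -compA k'k compm1.
  by apply: (iso_epi hf); rewrite -compA -e -bc -compA (compA k') k'k comp1m.
- by apply: (iso_epi (g := k)) => //; exists k'.
Qed.

Lemma pushout_mor_iso (A B D P A' B' D' P' : T)
    (i : Hom A B) (f : Hom A D) (k : Hom B P) (j : Hom D P)
    (i' : Hom A' B') (f' : Hom A' D') (k' : Hom B' P') (j' : Hom D' P')
    (a : Hom A A') (b : Hom B B') (d : Hom D D') (h : Hom P P') :
  is_pushout i f k j -> is_pushout i' f' k' j' ->
  is_iso a -> is_iso b -> is_iso d ->
  b ∘ i = i' ∘ a -> d ∘ f = f' ∘ a -> h ∘ k = k' ∘ b -> h ∘ j = j' ∘ d ->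
  is_iso h.
Proof.
move=> po po' ha [b' [b'b bb']] [d' [d'd dd']] ei ef ek ej.
have e : k ∘ b' ∘ i' = j ∘ d' ∘ f'.
  apply: (iso_epi ha); rewrite -!compA -ei -ef (compA b') b'b (compA d') d'd.
  by rewrite !comp1m (po_comm po).
have [h' [hk' hj']] := po_ex po' e; exists h'; split.
  apply: (po_eq po); rewrite comp1m -compA ?ek ?ej compA ?hk' ?hj' -compA.
    by rewrite b'b compm1.
  by rewrite d'd compm1.
apply: (po_eq po'); rewrite comp1m -compA ?hk' ?hj' compA ?ek ?ej -compA.
  by rewrite bb' compm1.
by rewrite dd' compm1.
Qed.

Lemma pushout_along_iso (A B D P P' : T) (i : Hom A B) (f : Hom A D) (k : Hom B P)
    (j : Hom D P) (k' : Hom B P') (j' : Hom D P') (h : Hom P P') :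
  is_pushout i f k' j' -> is_iso h -> h ∘ k = k' -> h ∘ j = j' -> is_pushout i f k j.
Proof.
move=> po ih hk hj; apply: pushoutI => [|Z b c e|Z u v uk uj].
- by apply: (iso_mono ih); rewrite !compA hk hj (po_comm po).
- have [u [uk uj]] := po_ex po e; exists (u ∘ h).
  by rewrite -!compA hk hj.
- have [h' [hh' h'h]] := ih.
  suff e : u ∘ h' = v ∘ h' by rewrite -[u]compm1 -[v]compm1 -hh' !compA e.
  have ek : h' ∘ k' = k by rewrite -hk compA hh' comp1m.
  have ej : h' ∘ j' = j by rewrite -hj compA hh' comp1m.
  by apply: (po_eq po); rewrite -!compA ?ek ?ej.
Qed.

Lemma po_unique (A B D P P' : T) (i : Hom A B) (f : Hom A D)
    (k : Hom B P) (j : Hom D P) (k' : Hom B P') (j' : Hom D P') :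
  is_pushout i f k j -> is_pushout i f k' j' ->
  exists h : Hom P P', [/\ is_iso h, h ∘ k = k' & h ∘ j = j'].
Proof.
move=> po po'; have [h [hk hj]] := po_ex po (po_comm po'); exists h; split=> //.
by apply: (pushout_mor_iso po po' (is_iso_id _) (is_iso_id _) (is_iso_id _));
   rewrite ?compm1 ?comp1m.
Qed.

End Categories.

Section CofibrationCategory.
Variables (C : PreCofCat) (hC : is_cofibration_category C).

Lemma cof_id (A : C) : cof (idm A).
Proof. by apply: (iso_cof hC); apply: is_iso_id. Qed.

Lemma weq_id (A : C) : weq (idm A).
Proof. by apply: (iso_weq hC); apply: is_iso_id. Qed.

(** (C3) provides one pushout with this property; uniqueness up to isomorphism extends it to all. *)
Lemma po_cof (A B D P : C) (i : Hom A B) (f : Hom A D) (k : Hom B P) (j : Hom D P) :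
  is_pushout i f k j -> cof i -> cof j.
Proof.
move=> po hi; have [P' [k' [j' [po' hj' _]]]] := cof_pushout hC f hi.
have [h [hh _ <-]] := po_unique po' po.
by apply: (cof_comp hC) => //; apply: (iso_cof hC).
Qed.

Lemma po_acof (A B D P : C) (i : Hom A B) (f : Hom A D) (k : Hom B P) (j : Hom D P) :
  is_pushout i f k j -> cof i -> weq i -> weq j.
Proof.
move=> po hi wi; have [P' [k' [j' [po' _ hj']]]] := cof_pushout hC f hi.
have [h [hh _ <-]] := po_unique po' po.
by apply: (weq_comp hC); [apply: hj' | apply: (iso_weq hC)].
Qed.

Lemma cof_po_ex (A B D : C) (i : Hom A B) (f : Hom A D) : cof i ->
  exists (P : C) (k : Hom B P) (j : Hom D P), is_pushout i f k j.
Proof. by move=> hi; have [P [k [j [po _ _]]]] := cof_pushout hC f hi; exists P, k, j. Qed.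

Section MapOfSpans.
Variables (A B D P A' B' D' P' : C).
Variables (i : Hom A B) (f : Hom A D) (k : Hom B P) (j : Hom D P).
Variables (i' : Hom A' B') (f' : Hom A' D') (k' : Hom B' P') (j' : Hom D' P').
Variables (a : Hom A A') (b : Hom B B') (d : Hom D D') (h : Hom P P').
Hypotheses (po : is_pushout i f k j) (po' : is_pushout i' f' k' j').
Hypothesis ef : d ∘ f = f' ∘ a.
Hypotheses (ek : h ∘ k = k' ∘ b) (ej : h ∘ j = j' ∘ d).

(** Gluing lemma for cofibrations: [h] is a cobase change of [d] followed by a cobase change of the
    corner map [t], whose source is the pushout of [B] and [A'] under [A]. *)
Lemma pushout_mor_cof (R : C) (r : Hom B R) (s : Hom A' R) (t : Hom R B') :
  is_pushout i a r s -> t ∘ r = b -> t ∘ s = i' -> cof t -> cof d -> cof h.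
Proof.
move=> poR tr ts ct cd.
have [S [e [g poS]]] := cof_po_ex j cd.
have po1 := pushout_paste po (pushout_sym poS).
have e1 : (g ∘ k) ∘ i = (e ∘ f') ∘ a.
  by rewrite -!compA -ef !compA (comp_eqr2 _ (po_comm po)) (po_comm poS).
have [m [mr ms]] := po_ex poR e1.
have po2 : is_pushout s f' m e.
  by apply: (pushout_cancel poR) => //; rewrite -ef mr.
have e2 : j' ∘ d = h ∘ j by rewrite ej.
have [n [ne ng]] := po_ex poS e2.
have po3 : is_pushout t m k' n.
  apply: pushout_sym; apply: (pushout_cancel (pushout_sym po2)) => //.
    by rewrite ts ne; apply: pushout_sym.
  apply: (po_eq poR).
    by rewrite -!compA mr tr compA ng.
  by rewrite -!compA ms ts compA ne (po_comm po').
rewrite -ng; apply: (cof_comp hC); first exact: (po_cof po3).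
exact: (po_cof poS).
Qed.

End MapOfSpans.

Lemma coproduct_ex (A B : C) : exists (S : C) (a : Hom A S) (b : Hom B S),
  [/\ cof a, cof b,
      forall Z (f : Hom A Z) (g : Hom B Z), exists h, h ∘ a = f /\ h ∘ b = g &
      forall Z (h h' : Hom S Z), h ∘ a = h' ∘ a -> h ∘ b = h' ∘ b -> h = h'].
Proof.
have [I hI] := has_initial hC.
have [u _] := initial_ex A hI; have [v _] := initial_ex B hI.
have cu := initial_cof hC u hI; have cv := initial_cof hC v hI.
have [S [a [b po]]] := cof_po_ex v cu; exists S, a, b; split.
- exact: (po_cof (pushout_sym po)).
- exact: (po_cof po).
- by move=> Z f g; apply: (po_ex po); apply: initial_eq.
- by move=> Z h h'; apply: (po_eq po).
Qed.

(* Ken Brown's lemma for the cobase change along [f], on the cofibrations under [A]. *)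
Lemma cobase_change_weq (A D Q1 Q2 P1 P2 : C) (f : Hom A D)
    (i1 : Hom A Q1) (i2 : Hom A Q2) (g : Hom Q1 Q2)
    (k1 : Hom Q1 P1) (j1 : Hom D P1) (k2 : Hom Q2 P2) (j2 : Hom D P2) (h : Hom P1 P2) :
  is_pushout i1 f k1 j1 -> is_pushout i2 f k2 j2 -> cof i1 -> cof i2 ->
  weq g -> g ∘ i1 = i2 -> h ∘ k1 = k2 ∘ g -> h ∘ j1 = j2 -> weq h.
Proof.
move=> po1 po2 c1 c2 wg e hk hj.
have [U [u1 [u2 poU]]] := cof_po_ex i2 c1.
have eU : g ∘ i1 = idm Q2 ∘ i2 by rewrite comp1m.
have [m [mu1 mu2]] := po_ex poU eU.
have [Z [z [p [cz wp mE]]]] := factorization hC m.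
have cu1 : cof (z ∘ u1).
  by apply: (cof_comp hC) => //; apply: (po_cof (pushout_sym poU)).
have cu2 : cof (z ∘ u2) by apply: (cof_comp hC) => //; apply: (po_cof poU).
have wu1 : weq (z ∘ u1) by apply: (weq_cancel_left hC wp); rewrite compA -mE mu1.
have wu2 : weq (z ∘ u2).
  by apply: (weq_cancel_left hC wp); rewrite compA -mE mu2; apply: weq_id.
have eZ : z ∘ u1 ∘ i1 = z ∘ u2 ∘ i2 by rewrite -!compA (po_comm poU).
(* [R1] is the cobase change of [Z] along [f], hence a pushout of [z ∘ u1] along [k1] and also of
   [z ∘ u2] along [k2]. So [y1] and [y2] are both acyclic cofibrations, and [r] with [r ∘ y1 = h]
   and [r ∘ y2 = idm P2] gives the claim by two out of three. *)
have [R1 [x1 [y1 poR1]]] := cof_po_ex k1 cu1.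
have poZ := pushout_paste (pushout_sym po1) (pushout_sym poR1).
have ez : y1 ∘ j1 ∘ f = x1 ∘ (z ∘ u2) ∘ i2.
  by rewrite (po_comm poZ) eZ !compA.
have [y2 [yk2 yj2]] := po_ex (pushout_sym po2) ez.
have poR2 : is_pushout k2 (z ∘ u2) y2 x1.
  by apply: (pushout_cancel (pushout_sym po2)) => //; rewrite yk2 -eZ.
have wy1 : weq y1 := po_acof poR1 cu1 wu1.
have wy2 : weq y2 := po_acof (pushout_sym poR2) cu2 wu2.
have er : (k2 ∘ p) ∘ (z ∘ u1) = h ∘ k1 by rewrite -(compA k2) (compA p) -mE mu1.
have [r [rx ry]] := po_ex poR1 er.
rewrite -ry; apply: (weq_comp hC) => //; apply: (weq_cancel_right hC wy2).
suff -> : r ∘ y2 = idm P2 by apply: weq_id.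
apply: (po_eq po2); rewrite comp1m.
  by rewrite -compA (po_comm poR2) compA rx -compA (compA p) -mE mu2 compm1.
by rewrite -compA yk2 compA ry.
Qed.

(** The weak equivalence [f] is traded for the acyclic cofibration [m ∘ (z ∘ in0)] into its mapping
    cylinder, whose cobase change [k' ∘ l] along [i] is a weak equivalence. It is linked to [k] by
    the weak equivalence [h], which arises on replacing [i] by the equivalent cofibration
    [n0 ∘ (z ∘ in1)] under [A]. *)
Lemma left_proper (A B D P : C) (i : Hom A B) (f : Hom A D) (k : Hom B P)
    (j : Hom D P) : is_pushout i f k j -> cof i -> weq f -> weq k.
Proof.
move=> po ci wf.
(* [Z] is a cylinder of [A], [M] the mapping cylinder of [f]. *)
have [S [in0 [in1 [c0 c1 Sex Seq]]]] := coproduct_ex A A.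
have [fold [fold0 fold1]] := Sex A (idm A) (idm A).
have [Z [z [p [cz wp foldE]]]] := factorization hC fold.
have p0 : p ∘ (z ∘ in0) = idm A by rewrite compA -foldE.
have p1 : p ∘ (z ∘ in1) = idm A by rewrite compA -foldE.
have w0 : weq (z ∘ in0) by apply: (weq_cancel_left hC wp); rewrite p0; apply: weq_id.
have w1 : weq (z ∘ in1) by apply: (weq_cancel_left hC wp); rewrite p1; apply: weq_id.
have cz0 : cof (z ∘ in0) by apply: (cof_comp hC).
have cz1 : cof (z ∘ in1) by apply: (cof_comp hC).
have [N [n0 [l poN]]] := cof_po_ex i cz0.
have wl : weq l := po_acof poN cz0 w0.
have e : (i ∘ p) ∘ (z ∘ in0) = idm B ∘ i by rewrite -compA p0 compm1 comp1m.
have [q [qn ql]] := po_ex poN e.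
have wq : weq q by apply: (weq_cancel_right hC wl); rewrite ql; apply: weq_id.
(* The end [in1] of [N] is a cofibration: [N] is also a pushout of [A + A -> Z]. *)
have [S' [b [a' [cb ca' Sex' Seq']]]] := coproduct_ex B A.
have [t [t0 t1]] := Sex S' (b ∘ i) a'.
have poS : is_pushout i in0 b t.
  apply: pushoutI => [|Y x y xy|Y x y xb xt]; first by rewrite t0.
    have [h [hb ha]] := Sex' Y x (y ∘ in1); exists h; split=> //.
    by apply: Seq; rewrite -compA ?t0 ?t1 // compA hb.
  by apply: Seq' => //; rewrite -t1 !compA xt.
have es : l ∘ i = n0 ∘ z ∘ in0 by rewrite -(po_comm poN) compA.
have [s [sb st]] := po_ex poS es.
have poS' : is_pushout t z s n0.
  by apply: (pushout_cancel poS) => //; rewrite sb; apply: pushout_sym.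
have cn1 : cof (n0 ∘ (z ∘ in1)).
  rewrite compA -st -compA t1; apply: (cof_comp hC) => //.
  exact: (po_cof (pushout_sym poS')).
have [P' [k' [j' po']]] := cof_po_ex f cn1.
have qi : q ∘ (n0 ∘ (z ∘ in1)) = i by rewrite compA qn -compA p1 compm1.
have eh : k ∘ q ∘ (n0 ∘ (z ∘ in1)) = j ∘ f by rewrite -(compA k) qi (po_comm po).
have [h [hk hj]] := po_ex po' eh.
have wh := cobase_change_weq po' po cn1 ci wq qi hk hj.
suff wk' : weq (k' ∘ l).
  by have := weq_comp hC wk' wh; rewrite compA hk -compA ql compm1.
have [M [m [n poM]]] := cof_po_ex f cz1.
have wm0 : weq (m ∘ (z ∘ in0)).
  apply: (weq_comp hC) => //; apply: (weq_cancel_right hC w1).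
  by rewrite (po_comm poM); apply: (weq_comp hC) => //; apply: (po_acof poM).
have em : k' ∘ n0 ∘ (z ∘ in1) = j' ∘ f by rewrite -compA (po_comm po').
have [x [xm xn]] := po_ex poM em.
have poX : is_pushout n0 m k' x.
  apply: pushout_sym; apply: (pushout_cancel (pushout_sym poM)) => //.
  by rewrite xn; apply: pushout_sym.
have poL : is_pushout i (m ∘ (z ∘ in0)) (k' ∘ l) x.
  exact: (pushout_paste (pushout_sym poN) poX).
apply: (po_acof (pushout_sym poL)) => //.
(* The other end of the mapping cylinder is a cofibration as well. *)
have [V [v [d [cv cd Vex Veq]]]] := coproduct_ex A D.
have [y [y0 y1]] := Sex V v (d ∘ f).
have poV : is_pushout in1 f y d.
  apply: pushoutI => // [Y x1 x2 xx|Y x1 x2 e1 e2].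
    have [h1 [hv hd]] := Vex Y (x1 ∘ in0) x2; exists h1; split=> //.
    by apply: Seq; rewrite -compA ?y0 ?y1 // compA hd.
  by apply: Veq => //; rewrite -y0 !compA e1.
have ev : m ∘ z ∘ in1 = n ∘ f by rewrite -compA (po_comm poM).
have [w [wy wd]] := po_ex poV ev.
have poW : is_pushout z y m w.
  apply: pushout_sym; apply: (pushout_cancel (pushout_sym poV)) => //.
  by rewrite wd; apply: pushout_sym.
rewrite compA -wy -compA y0; apply: (cof_comp hC) => //.
exact: (po_cof poW).
Qed.

(** [h] splits as [n ∘ g]. Here [g] is the cobase change of [d] along the cofibration [j], a weak
    equivalence by [left_proper], and [n] is the map that [t], a weak equivalence of cofibrations
    under [A'], induces after cobase change along [f']. *)
Lemma gluing (A B D P A' B' D' P' : C)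
    (i : Hom A B) (f : Hom A D) (k : Hom B P) (j : Hom D P)
    (i' : Hom A' B') (f' : Hom A' D') (k' : Hom B' P') (j' : Hom D' P')
    (a : Hom A A') (b : Hom B B') (d : Hom D D') (h : Hom P P') :
  is_pushout i f k j -> is_pushout i' f' k' j' -> cof i -> cof i' ->
  weq a -> weq b -> weq d ->
  b ∘ i = i' ∘ a -> d ∘ f = f' ∘ a -> h ∘ k = k' ∘ b -> h ∘ j = j' ∘ d ->
  weq h.
Proof.
move=> po po' ci ci' wa wb wd ei ef ek ej.
have cj : cof j := po_cof po ci.
have [R [r [s poR]]] := cof_po_ex a ci.
have [t [tr ts]] := po_ex poR ei.
have wt : weq t.
  by apply: (weq_cancel_right hC (left_proper poR ci wa)); rewrite tr.
have [S [g [e poS]]] := cof_po_ex d cj.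
have wg : weq g := left_proper poS cj wd.
have po1 := pushout_paste po poS.
have e1 : (g ∘ k) ∘ i = (e ∘ f') ∘ a.
  by rewrite (po_comm po1) ef compA.
have [m [mr ms]] := po_ex poR e1.
have po2 : is_pushout s f' m e.
  by apply: (pushout_cancel poR) => //; rewrite mr -ef.
have [n [ng ne]] := po_ex poS ej.
rewrite -ng; apply: (weq_comp hC) => //.
apply: (cobase_change_weq po2 po' _ ci' wt ts _ ne); first exact: (po_cof poR).
by apply: (po_eq poR); rewrite -!compA ?mr ?ms ?tr ?ts ?compA ?ng ?ne ?ek ?(po_comm po').
Qed.

End CofibrationCategory.

(** * Latching objects *)

Section Representations.
Variable C : Category.

Lemma dmap_congr (K L : DeltaSet) (s t : DeltaMap K L) n (x : K n) :
  s = t -> s n x = t n x.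
Proof. by move=> ->. Qed.

Section Rep.
Variables (K : DeltaSet) (A : coDelta C) (P : representation K A).

Lemma rep_univE (Z : C) (h : Hom P Z) k (y : K k) :
  rep_to h k y = h ∘ rep_univ P k y.
Proof.
have e := rep_to_nat h (idm (rep_ob P)).
rewrite -[in LHS](compm1 h).
exact: (dmap_congr y e).
Qed.

Lemma rep_ofE (Z : C) (t : DeltaMap K (map_set A Z)) k (y : K k) :
  rep_of P t ∘ rep_univ P k y = t k y.
Proof. by rewrite -rep_univE rep_ofK. Qed.

Lemma rep_eq (Z : C) (h h' : Hom P Z) :
  (forall k (y : K k), h ∘ rep_univ P k y = h' ∘ rep_univ P k y) -> h = h'.
Proof.
move=> e; rewrite -(rep_toK h) -(rep_toK h').
suff -> : rep_to h = rep_to h' by [].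
by apply: dmap_eq => k y; rewrite (rep_univE h) (rep_univE h') e.
Qed.

Lemma rep_univ_face k l (a : @Hom Delta k l) (y : K l) :
  rep_univ P k (face K a y) = rep_univ P l y ∘ fhom A a.
Proof. exact: (dmap_nat (rep_univ P)). Qed.

End Rep.

Section MkRep.
Variables (K : DeltaSet) (A : coDelta C) (L : C) (u : DeltaMap K (map_set A L)).
Hypothesis u_ex : forall (Z : C) (t : DeltaMap K (map_set A Z)),
  exists h : Hom L Z, forall k (y : K k), h ∘ u k y = t k y.
Hypothesis u_eq : forall (Z : C) (h h' : Hom L Z),
  (forall k (y : K k), h ∘ u k y = h' ∘ u k y) -> h = h'.

Program Definition mk_rep : representation K A :=
  @MkRepresentation C K A L (fun Z h => compD (map_set_post A h) u)
    (fun Z t => sval (cid (u_ex t))) _ _ _.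
Next Obligation. by move=> Z h /=; case: cid => h' /= e; apply: u_eq. Qed.
Next Obligation. by move=> Z t; apply: dmap_eq => k y /=; case: cid => h' /= ->. Qed.
Next Obligation. by move=> Z Z' g h; apply: dmap_eq => k y /=; rewrite compA. Qed.

Lemma mk_rep_univ k (y : K k) : rep_univ mk_rep k y = u k y.
Proof. exact: comp1m. Qed.

End MkRep.

Lemma rep_morE (K L : DeltaSet) (A B : coDelta C) (i : DeltaMap K L) (f : Hom A B)
    (P : representation K A) (Q : representation L B) k (y : K k) :
  rep_mor i f P Q ∘ rep_univ P k y = rep_univ Q k (i k y) ∘ f k.
Proof. by rewrite rep_ofE. Qed.

Lemma latching_mapE n (A : coDelta C) (P : latching n A) k (y : boundary n k) :
  latching_map P ∘ rep_univ P k y = fhom A (sval y).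
Proof.
have := rep_morE (boundary_incl n) (idm A) P (simplex_rep n A) y.
by rewrite /= compm1 comp1m.
Qed.

Lemma latching_morE n (A B : coDelta C) (f : Hom A B) (P : latching n A)
    (Q : latching n B) k (y : boundary n k) :
  latching_mor f P Q ∘ rep_univ P k y = rep_univ Q k y ∘ f k.
Proof. exact: rep_morE. Qed.

Lemma latching_map_nat n (A B : coDelta C) (f : Hom A B) (P : latching n A)
    (Q : latching n B) : f n ∘ latching_map P = latching_map Q ∘ latching_mor f P Q.
Proof.
apply: rep_eq => k y; rewrite -!compA latching_mapE latching_morE compA.
by rewrite latching_mapE nt_nat.
Qed.

Lemma latching_morM n (A B D : coDelta C) (f : Hom A B) (g : Hom B D)
    (P : latching n A) (Q : latching n B) (R : latching n D) :
  latching_mor (g ∘ f) P R = latching_mor g Q R ∘ latching_mor f P Q.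
Proof.
apply: rep_eq => k y; rewrite latching_morE -compA latching_morE compA latching_morE.
by rewrite /= compA.
Qed.

Lemma latching_mor1 n (A : coDelta C) (P : latching n A) :
  latching_mor (idm A) P P = idm (rep_ob P).
Proof. by apply: rep_eq => k y; rewrite latching_morE /= compm1 comp1m. Qed.

Lemma boundary_lt n k (y : boundary n k) : k < n.
Proof.
rewrite ltn_neqAle (Delta_hom_leq (sval y)) andbT; apply/eqP => e.
by case: y => y /= hy; apply/hy/Delta_is_idmE.
Qed.

(* The inverses of the components need not form a natural transformation. *)
Lemma latching_lift n (A B : coDelta C) (g : Hom A B) (Q : latching n B) :
  (forall k, k < n -> is_iso (g k)) ->
  exists P : latching n A, is_iso (latching_mor g P Q).
Proof.
move=> gi.
pose u : DeltaMap (boundary n) (map_set A Q) := compD (map_set_pre g Q) (rep_univ Q).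
have u_ex (Z : C) (t : DeltaMap (boundary n) (map_set A Z)) :
    exists h : Hom Q Z, forall k (y : boundary n k), h ∘ u k y = t k y.
  pose inv k (y : boundary n k) := cid (gi k (boundary_lt y)).
  have tnat k l (a : @Hom Delta k l) (y : boundary n l) :
      t k (face (boundary n) a y) ∘ sval (inv k (face _ a y))
      = t l y ∘ sval (inv l y) ∘ fhom B a.
    apply: (iso_epi (gi k (boundary_lt (face _ a y)))).
    rewrite -!compA -nt_nat; case: (inv _ _) => v /= [-> _]; case: (inv _ _) => w /= [e _].
    by rewrite (compA w) e comp1m compm1 dmap_nat.
  pose t' := @MkDeltaMap (boundary n) (map_set B Z)
    (fun k y => t k y ∘ sval (inv k y)) tnat.
  exists (rep_of Q t') => k y /=; rewrite compA rep_ofE /=.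
  by case: (inv _ _) => w /= [e _]; rewrite -compA e compm1.
have u_eq (Z : C) (h h' : Hom Q Z) :
    (forall k (y : boundary n k), h ∘ u k y = h' ∘ u k y) -> h = h'.
  move=> e; apply: rep_eq => k y; apply: (iso_epi (gi k (boundary_lt y))).
  by rewrite -!compA; apply: e.
exists (mk_rep u_ex u_eq).
suff -> : latching_mor g (mk_rep u_ex u_eq) Q = idm (rep_ob Q) by apply: is_iso_id.
by apply: rep_eq => k y; rewrite latching_morE mk_rep_univ /= comp1m.
Qed.

(** Degrees below [n] suffice because [boundary n] has no other cells. For [g = idm A] this compares
    two choices of a latching object. *)
Lemma latching_mor_iso n (A B : coDelta C) (g : Hom A B) (P : latching n A)
    (Q : latching n B) :
  (forall k, k < n -> is_iso (g k)) -> is_iso (latching_mor g P Q).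
Proof.
move=> gi; have [P' P'i] := latching_lift Q gi.
rewrite -[g]compm1 (latching_morM _ _ P P'); apply: is_iso_comp => //.
by exists (latching_mor (idm A) P' P); rewrite -!latching_morM comp1m !latching_mor1.
Qed.

Lemma latching_initial n (A : coDelta C) (P : latching n A) :
  (forall k, is_initial (A k)) -> is_initial (rep_ob P).
Proof.
move=> hA Z.
have tnat k l (a : @Hom Delta k l) (y : boundary n l) :
    sval (cid (initial_ex Z (hA k))) = sval (cid (initial_ex Z (hA l))) ∘ fhom A a.
  exact: initial_eq.
exists (rep_of P (@MkDeltaMap (boundary n) (map_set A Z)
         (fun k y => sval (cid (initial_ex Z (hA k)))) tnat)); split=> // h _.
by apply: rep_eq => k y; apply: initial_eq.
Qed.

End Representations.

(** * Relative latching maps in a single degree *)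

Section RelativeLatching.
Variables (C : PreCofCat) (hC : is_cofibration_category C).

(** One degree of [is_cofibration], isolated because the factorization is built degree by degree and
    each stage satisfies the condition only in the degrees already treated. *)
Definition cof_at (n : nat) (A B : coDelta C) (f : Hom A B) : Prop :=
  exists (P : latching n A) (Q : latching n B) (R : C)
         (a : Hom (A n) R) (b : Hom (rep_ob Q) R) (h : Hom R (B n)),
    [/\ is_pushout (latching_map P) (latching_mor f P Q) a b,
        h ∘ a = f n, h ∘ b = latching_map Q & cof h].

Definition cofibrant_at (n : nat) (A : coDelta C) : Prop :=
  exists P : latching n A, cof (latching_map P).

Lemma cof_at_any n (A B : coDelta C) (f : Hom A B) (P : latching n A)
    (Q : latching n B) (R : C) (a : Hom (A n) R) (b : Hom (rep_ob Q) R)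
    (h : Hom R (B n)) :
  cof_at n f -> is_pushout (latching_map P) (latching_mor f P Q) a b ->
  h ∘ a = f n -> h ∘ b = latching_map Q -> cof h.
Proof.
move=> [P' [Q' [R' [a' [b' [h' [po' ha' hb' ch']]]]]]] po ha hb.
pose p := latching_mor (idm A) P P'; pose q := latching_mor (idm B) Q Q'.
have ip : is_iso p by apply: latching_mor_iso => k _; apply: is_iso_id.
have iq : is_iso q by apply: latching_mor_iso => k _; apply: is_iso_id.
have e1 : idm _ ∘ latching_map P = latching_map P' ∘ p.
  exact: (latching_map_nat (idm A)).
have e2 : q ∘ latching_mor f P Q = latching_mor f P' Q' ∘ p.
  by rewrite -!latching_morM comp1m compm1.
have e3 : a' ∘ latching_map P = b' ∘ q ∘ latching_mor f P Q.
  by rewrite -[X in X ∘ _]compm1 -compA e1 -compA e2 !compA (po_comm po').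
have [r [ra rb]] := po_ex po e3.
have ir : is_iso r.
  by apply: (pushout_mor_iso po po' ip (is_iso_id _) iq e1 e2); rewrite ?compm1.
have -> : h = h' ∘ r.
  apply: (po_eq po); rewrite -compA ?ra ?rb ?ha ?hb ?ha' // compA hb'.
  by rewrite -(latching_map_nat (idm B)) /= comp1m.
by apply: (cof_comp hC) => //; apply: (iso_cof hC).
Qed.

Lemma cofibrant_at_any n (A : coDelta C) (P : latching n A) :
  cofibrant_at n A -> cof (latching_map P).
Proof.
move=> [P' cP']; have := latching_map_nat (idm A) P P'; rewrite comp1m => ->.
apply: (cof_comp hC) => //; apply: (iso_cof hC); apply: latching_mor_iso => k _.
exact: is_iso_id.
Qed.

(* [cof_at n] for [f], tested on the latching data of a [D] which [B] resembles in
   degrees below [n]. *)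
Lemma cof_at_transfer n (A B D : coDelta C) (f : Hom A B) (g : Hom B D)
    (P : latching n A) (Q : latching n D) (R : C) (a : Hom (A n) R)
    (b : Hom (rep_ob Q) R) (h : Hom R (B n)) :
  (forall k, k < n -> is_iso (g k)) ->
  is_pushout (latching_map P) (latching_mor (g ∘ f) P Q) a b ->
  h ∘ a = f n ->
  (forall k (y : boundary n k), h ∘ b ∘ rep_univ Q k y ∘ g k = fhom B (sval y)) ->
  cof h -> cof_at n f.
Proof.
move=> gi po ha hb ch; have [Q' iQ'] := latching_lift Q gi.
exists P, Q', R, a, (b ∘ latching_mor g Q' Q), h; split=> //.
  have ii : is_iso (idm R) by apply: is_iso_id.
  have [v [vq qv]] := iQ'.
  apply: pushoutI => [|Z x y xy|Z x y e1 e2].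
  - by rewrite (po_comm po) (latching_morM _ _ P Q') compA.
  - have e : x ∘ latching_map P = y ∘ v ∘ latching_mor (g ∘ f) P Q.
      by rewrite xy (latching_morM _ _ P Q') -!compA (compA v) vq comp1m.
    have [z [za zb]] := po_ex po e; exists z; split=> //.
    by rewrite compA zb -compA vq compm1.
  - by apply: (po_eq po) => //; apply: (iso_epi iQ'); rewrite -!compA.
apply: rep_eq => k y; rewrite latching_mapE -!compA latching_morE !compA.
exact: hb.
Qed.

(** The relative latching map of [g ∘ f] is [h ∘ r]: a cobase change [r] of the one of [f], followed
    by the one of [g]. *)
Lemma cof_at_comp n (A B D : coDelta C) (f : Hom A B) (g : Hom B D) :
  cofibrant_at n A -> cof_at n f -> cof_at n g -> cof_at n (g ∘ f).
Proof.
move=> cA cf [Q [S [R [a [b [h [po ha hb ch]]]]]]].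
case: cA => P cP.
have [U [u [v poU]]] := cof_po_ex hC (latching_mor f P Q) cP.
have [t [tu tv]] := po_ex poU (latching_map_nat f P Q).
have ct : cof t := cof_at_any cf poU tu tv.
have [V [x [y poV]]] := cof_po_ex hC (latching_mor (g ∘ f) P S) cP.
have e : x ∘ latching_map P = y ∘ latching_mor g Q S ∘ latching_mor f P Q.
  by rewrite -compA -latching_morM (po_comm poV).
have [w [wu wv]] := po_ex poU e.
have poW : is_pushout v (latching_mor g Q S) w y.
  by apply: (pushout_cancel poU) => //; rewrite wu -latching_morM.
have e' : (a ∘ t) ∘ v = b ∘ latching_mor g Q S by rewrite -compA tv (po_comm po).
have [r [rw ry]] := po_ex poW e'.
have poR : is_pushout w t r a.
  apply: (pushout_cancel (pushout_sym poW)) => //.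
    by rewrite tv ry; apply: pushout_sym.
exists P, S, V, x, y, (h ∘ r); split=> //.
- by rewrite -wu compA (comp_eqr _ rw) compA ha -compA tu.
- by rewrite -compA ry hb.
- apply: (cof_comp hC) => //; exact: (po_cof hC (pushout_sym poR)).
Qed.

(** The source inherits a latching object from the target by [latching_lift], and with [B n] as
    pushout the relative latching map is an identity. *)
Lemma cof_at_iso n (A B : coDelta C) (f : Hom A B) :
  (forall k, k <= n -> is_iso (f k)) -> cofibrant_at n B -> cof_at n f.
Proof.
move=> fi [Q cQ].
have [P iP] := latching_lift Q (fun k hk => fi k (ltnW hk)).
exists P, Q, (B n), (f n), (latching_map Q), (idm _).
split; rewrite ?comp1m //; last exact: cof_id.
apply: pushout_of_isos => //; first exact: fi.
exact: latching_map_nat.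
Qed.

Lemma cof_at_id n (A : coDelta C) : cofibrant_at n A -> cof_at n (idm A).
Proof. by apply: cof_at_iso => k _; apply: is_iso_id. Qed.

Lemma cofibrant_at_cof n (A B : coDelta C) (f : Hom A B) :
  cofibrant_at n A -> cof_at n f -> cofibrant_at n B.
Proof.
move=> cA [P [Q [R [a [b [h [po ha hb ch]]]]]]]; exists Q.
rewrite -hb; apply: (cof_comp hC) => //; apply: (po_cof hC po).
exact: cofibrant_at_any.
Qed.

Lemma cof_at_initial n (A B : coDelta C) (f : Hom A B) :
  (forall k, is_initial (A k)) -> cofibrant_at n A -> cofibrant_at n B -> cof_at n f.
Proof.
move=> hA [P _] [Q cQ].
have [a _] := initial_ex (rep_ob Q) (hA n).
exists P, Q, (rep_ob Q), a, (idm _), (latching_map Q); rewrite compm1.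
have hP := latching_initial P hA.
split=> //; last exact: initial_eq.
apply: pushout_sym; apply: pushout_of_isos; last exact: initial_eq.
  exact: initial_isoP.
exact: is_iso_id.
Qed.

End RelativeLatching.

(** * Attaching one cell to a sub-Delta-set *)

Definition is_closed (K : DeltaSet) (S : forall k, K k -> Prop) : Prop :=
  forall k l (a : @Hom Delta k l) (x : K l), S l x -> S k (face K a x).

Program Definition sub_set (K : DeltaSet) (S : forall k, K k -> Prop)
    (hS : is_closed S) : DeltaSet :=
  @MkDeltaSet (fun k => {x : K k | S k x})
    (fun k l a x => exist _ (face K a (sval x)) (hS k l a (sval x) (svalP x))) _ _.
Next Obligation. by move=> K S hS n [x hx]; apply: eq_exist; apply: face1. Qed.
Next Obligation. by move=> K S hS n m p b a [x hx]; apply: eq_exist; apply: faceM. Qed.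

(** Transport along an equality of cells whose dimensions are only provably equal. *)
Lemma existT_ind (I : Type) (K : I -> Type) (i j : I) (x : K i) (y : K j)
    (Q : forall i, K i -> Prop) : existT K i x = existT K j y -> Q j y -> Q i x.
Proof. by move=> e; rewrite (congr1 (fun s => Q (projT1 s) (projT2 s)) e). Qed.

Lemma existT_inj (I : Type) (K : I -> Type) (i : I) (x y : K i) :
  existT K i x = existT K i y -> x = y.
Proof.
by move=> e; have := projT2_eq e; rewrite (Prop_irrelevance (projT1_eq e) erefl).
Qed.

Section Attach.
Variables (K : DeltaSet) (S : forall k, K k -> Prop) (d : nat) (x : K d).
Hypotheses (hS : is_closed S) (Sx : ~ S x).
Hypothesis Sface : forall l (a : @Hom Delta l d), ~ is_idm a -> S (face K a x).

Definition attach (l : nat) (y : K l) : Prop := S y \/ existT K l y = existT K d x.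

Lemma attach_l l (y : K l) : S y -> attach y. Proof. by left. Qed.
Lemma attach_r : attach x. Proof. by right. Qed.

Lemma attach_closed : is_closed attach.
Proof.
move=> k l a y [Sy|e]; first by left; apply: hS.
move: k a; apply: (existT_ind (Q := fun l y => forall k a, attach (face K a y)) e).
move=> k a; have [ia|ia] := pselect (is_idm a); last by left; apply: Sface.
right; apply: (existT_ind (K := fun k => @Hom Delta k d)
  (Q := fun k a => existT K k (face K a x) = existT K d x) ia).
by rewrite face1.
Qed.

Lemma attach_ind (Q : forall l, sub_set attach_closed l -> Prop) :
  (forall l (y : K l) (h : S y), Q l (exist _ y (attach_l h))) ->
  Q d (exist _ x attach_r) -> forall l y, Q l y.
Proof.
move=> QS Qx l [y h].
have [Sy|nSy] := pselect (S y); first by rewrite (Prop_irrelevance h (attach_l Sy)).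
have [//|e] := h; move: h.
apply: (existT_ind (Q := fun l y => forall h, Q l (exist _ y h)) e) => h.
by rewrite (Prop_irrelevance h attach_r).
Qed.

Variable C : Category.

(** Attaching [x] along its proper faces is a pushout of Delta-sets. By [Sx] the value chosen on [x]
    cannot clash with [s], and [Sface] leaves compatibility to be checked on proper faces only. *)
Lemma attach_map (A : coDelta C) (Z : C) (s : DeltaMap (sub_set hS) (map_set A Z))
    (m : Hom (A d) Z) :
  (forall l (a : @Hom Delta l d) (na : ~ is_idm a),
      m ∘ fhom A a = s l (exist _ (face K a x) (Sface na))) ->
  exists t : DeltaMap (sub_set attach_closed) (map_set A Z),
    (forall l (y : K l) (h : S y), t l (exist _ y (attach_l h)) = s l (exist _ y h)) /\
    t d (exist _ x attach_r) = m.
Proof.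
move=> sm.
(* A value over a cell equal to [x] has a type depending on its dimension, so it is compared with
   [m] as a dependent pair over the cell. *)
pose E (c : {l & K l}) := Hom (A (projT1 c)) Z.
pose Q l (y : K l) (v : Hom (A l) Z) :=
  (forall h : S y, v = s l (exist _ y h)) /\
  (existT K l y = existT K d x -> existT E (existT K l y) v = existT E (existT K d x) m).
have Qex l (y : {y : K l | attach y}) : exists v, Q l (sval y) v.
  case: y => y /= [Sy|e].
    exists (s l (exist _ y Sy)); split=> [h|e]; first by rewrite (Prop_irrelevance h Sy).
    by case: Sx; apply: (existT_ind (esym e) Sy).
  by apply: (existT_ind (Q := fun l y => exists v, Q l y v) e); exists m.
pose t l y := sval (cid (Qex l y)).
have tS l (y : K l) (h : S y) h' : t l (exist _ y h') = s l (exist _ y h).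
  by rewrite /t; case: cid => v /= [-> _].
have tx h' : t d (exist _ x h') = m.
  by rewrite /t; case: cid => v /= [_ h]; apply: (existT_inj (K := E) (h erefl)).
have tnat k l (a : @Hom Delta k l) (y : sub_set attach_closed l) :
    t k (face (sub_set attach_closed) a y) = t l y ∘ fhom A a.
  case: y => y h /=; set h' := attach_closed _ _.
  have [Sy|nSy] := pselect (S y).
    rewrite (tS _ _ (hS a Sy)) (tS _ _ Sy).
    rewrite -[RHS](dmap_nat s a (exist _ y Sy)); congr (s k _); exact: eq_exist.
  have [//|e] := h; move: h h'.
  apply: (existT_ind (Q := fun l y => forall (a : @Hom Delta k l) h h',
            t k (exist _ (face K a y) h') = t l (exist _ y h) ∘ fhom A a) e) => {}a h h'.
  rewrite tx; have [ia|ia] := pselect (is_idm a); last by rewrite sm (tS _ _ (Sface ia)).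
  move: h'; apply: (existT_ind (Q := fun k (a : @Hom Delta k d) => forall h',
            t k (exist _ (face K a x) h') = m ∘ fhom A a) ia).
  by rewrite fhom1 compm1 face1 => h'; apply: tx.
exists (@MkDeltaMap (sub_set attach_closed) (map_set A Z) t tnat).
by split=> [l y h|]; [apply: tS | apply: tx].
Qed.

Variables (A : coDelta C) (PS : representation (sub_set hS) A) (P : latching d A).

Lemma attach_face_subproof (k l : nat) (a : @Hom Delta k l) (y : boundary d l) :
  rep_univ PS k (exist _ (face K (sval (face (boundary d) a y)) x)
    (Sface (svalP (face (boundary d) a y))))
  = rep_univ PS l (exist _ (face K (sval y) x) (Sface (svalP y))) ∘ fhom A a.
Proof.
rewrite -rep_univ_face; congr (rep_univ PS k _); apply: eq_exist.
exact: faceM.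
Qed.

(** The map on representing objects induced by [boundary d -> S], the characteristic map of [x]
    restricted to the boundary. *)
Definition attaching_map : Hom (rep_ob P) (rep_ob PS) :=
  rep_of P (@MkDeltaMap (boundary d) (map_set A PS)
    (fun l y => rep_univ PS l (exist _ (face K (sval y) x) (Sface (svalP y))))
    attach_face_subproof).

Lemma attaching_mapE l (y : boundary d l) :
  attaching_map ∘ rep_univ P l y
  = rep_univ PS l (exist _ (face K (sval y) x) (Sface (svalP y))).
Proof. by rewrite rep_ofE. Qed.

(** [- ∩ A] turns the pushout of Delta-sets that attaches [x] into a pushout in [C]; read backwards,
    a pushout in [C] represents the larger set. The proof takes [r] to be the identity; it appears
    in the statement because the object of an existentially bound [P'] is not visibly [R]. *)
Lemma attach_rep (R : C) (k : Hom (A d) R) (j : Hom PS R) :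
  is_pushout (latching_map P) attaching_map k j ->
  exists (P' : representation (sub_set attach_closed) A) (r : Hom R (rep_ob P')),
    [/\ is_iso r,
        forall l (y : K l) (h : S y),
          rep_univ P' l (exist _ y (attach_l h)) = r ∘ j ∘ rep_univ PS l (exist _ y h) &
        rep_univ P' d (exist _ x attach_r) = r ∘ k].
Proof.
move=> po.
have sm l (a : @Hom Delta l d) (na : ~ is_idm a) :
    k ∘ fhom A a = compD (map_set_post A j) (rep_univ PS) l
      (exist _ (face K a x) (Sface na)).
  have := latching_mapE P (exist _ a na : boundary d l) => /= <-.
  rewrite compA (po_comm po) -compA attaching_mapE /=.
  by congr (j ∘ rep_univ PS l _); apply: eq_exist.
have [u [uS ux]] := attach_map sm.
have u_ex (Z : C) (t : DeltaMap (sub_set attach_closed) (map_set A Z)) :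
    exists h : Hom R Z, forall l y, h ∘ u l y = t l y.
  have snat p q (a : @Hom Delta p q) (y : sub_set hS q) :
      t p (exist _ (sval (face (sub_set hS) a y))
             (attach_l (svalP (face (sub_set hS) a y))))
      = t q (exist _ (sval y) (attach_l (svalP y))) ∘ fhom A a.
    rewrite -[RHS](dmap_nat t a (exist _ (sval y) (attach_l (svalP y)))).
    by congr (t p _); apply: eq_exist.
  pose s := @MkDeltaMap (sub_set hS) (map_set A Z)
    (fun l y => t l (exist _ (sval y) (attach_l (svalP y)))) snat.
  have e : t d (exist _ x attach_r) ∘ latching_map P = rep_of PS s ∘ attaching_map.
    apply: rep_eq => l y; rewrite -!compA latching_mapE attaching_mapE rep_ofE /=.
    rewrite -[LHS](dmap_nat t (sval y) (exist _ x attach_r)).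
    by congr (t l _); apply: eq_exist.
  have [h [hk hj]] := po_ex po e; exists h.
  apply: attach_ind => [l y Sy|]; last by rewrite ux hk.
  by rewrite uS /= compA hj rep_ofE /=; congr (t l _); apply: eq_exist.
have u_eq (Z : C) (h h' : Hom R Z) :
    (forall l (y : sub_set attach_closed l), h ∘ u l y = h' ∘ u l y) -> h = h'.
  move=> e; apply: (po_eq po); first by rewrite -ux.
  apply: rep_eq => l [y Sy]; have := e l (exist _ y (attach_l Sy)).
  by rewrite uS /= !compA.
exists (mk_rep u_ex u_eq), (idm R); split; first exact: is_iso_id.
  by move=> l y h; rewrite mk_rep_univ comp1m; apply: uS.
by rewrite mk_rep_univ comp1m; apply: ux.
Qed.

End Attach.

Lemma delta_set_eq (X : nat -> Type)
    (f g : forall n m : nat, @Hom Delta n m -> X m -> X n) f1 fM g1 gM :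
  (forall n m a x, f n m a x = g n m a x) ->
  @MkDeltaSet X f f1 fM = @MkDeltaSet X g g1 gM.
Proof.
move=> fg; have e : f = g.
  apply: functional_extensionality_dep => n; apply: functional_extensionality_dep => m.
  by apply: functional_extensionality_dep => a; apply/funext => x.
by case: _ / e g1 gM => g1 gM; congr MkDeltaSet; apply: Prop_irrelevance.
Qed.

Lemma boundary_sub_set n (hS : is_closed (fun k (y : simplex n k) => ~ is_idm y)) :
  sub_set hS = boundary n.
Proof. by apply: delta_set_eq => k l a y; apply: eq_exist. Qed.

(** * Induction over the cells of a boundary *)

Section Cells.
Variables (C : PreCofCat) (hC : is_cofibration_category C).
Variables (A B : coDelta C) (f : Hom A B) (n : nat).
Hypothesis cA : forall d, d < n -> cofibrant_at d A.
Hypothesis cf : forall d, d < n -> cof_at d f.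

Definition cof_on (K : DeltaSet) : Prop :=
  exists (P : representation K A) (Q : representation K B), cof (rep_mor (idD K) f P Q).

Definition cof_on_sub (K : DeltaSet) (S : forall k, K k -> Prop) : Prop :=
  exists hS : is_closed S, cof_on (sub_set hS).

(** Attaching a [d]-cell presents the map for the larger set as a map of pushouts, with corner map
    the relative latching map of [f] in degree [d]; [pushout_mor_cof] then applies. Cofibrancy of
    [A] and [B] in degree [d] makes these pushouts exist, so representability is carried along. *)
Lemma cof_on_attach (K : DeltaSet) (S : forall k, K k -> Prop) d (x : K d) :
  d < n -> ~ S d x -> (forall l (a : @Hom Delta l d), ~ is_idm a -> S l (face K a x)) ->
  cof_on_sub S -> cof_on_sub (attach S x).
Proof.
move=> dn Sx Sface [hS [PA [PB cg]]]; set g := rep_mor _ _ _ _ in cg.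
have cB := cofibrant_at_cof hC (cA dn) (cf dn).
have [P [Q [R [a [b [t [poR ta tb ct]]]]]]] := cf dn.
have cP := cofibrant_at_any hC P (cA dn).
have cQ := cofibrant_at_any hC Q cB.
have [RA [kA [jA poA]]] := cof_po_ex hC (attaching_map Sface PA P) cP.
have [RB [kB [jB poB]]] := cof_po_ex hC (attaching_map Sface PB Q) cQ.
have ef : g ∘ attaching_map Sface PA P
          = attaching_map Sface PB Q ∘ latching_mor f P Q.
  apply: rep_eq => l y; rewrite -!compA latching_morE attaching_mapE.
  by rewrite compA attaching_mapE rep_morE.
have eh : kB ∘ f d ∘ latching_map P = jB ∘ g ∘ attaching_map Sface PA P.
  by rewrite -!compA (latching_map_nat f P Q) ef !compA (po_comm poB).
have [h [hk hj]] := po_ex poA eh.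
have ch : cof h.
  exact: (pushout_mor_cof hC poA poB ef hk hj poR ta tb).
exists (attach_closed hS Sface).
have [PA' [rA [[vA [vrA rvA]] uA xA]]] := attach_rep Sx poA.
have [PB' [rB [iB uB xB]]] := attach_rep Sx poB.
exists PA', PB'.
have -> : rep_mor (idD (sub_set (attach_closed hS Sface))) f PA' PB' = rB ∘ h ∘ vA.
  apply: rep_eq; apply: attach_ind => [l y Sy|]; rewrite rep_morE.
    rewrite uA uB !compA (comp_eqr _ vrA) compm1 (comp_eqr _ hj) !compA.
    by rewrite (comp_eqr _ (rep_morE _ _ _ _ _)) !compA.
  by rewrite xA xB !compA (comp_eqr _ vrA) compm1 (comp_eqr _ hk) !compA.
apply: (cof_comp hC); last by apply: (iso_cof hC); exists rA.
by apply: (cof_comp hC) => //; apply: (iso_cof hC).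
Qed.

Lemma cof_on_empty (K : DeltaSet) (S : forall k, K k -> Prop) :
  (forall k x, ~ S k x) -> cof_on_sub S.
Proof.
move=> S0; have hS : is_closed S by move=> k l a x /S0.
exists hS; have [I hI] := has_initial hC.
have mk (D : coDelta C) : exists P : representation (sub_set hS) D, is_initial (rep_ob P).
  have no k (y : sub_set hS k) : False := S0 _ _ (svalP y).
  pose u : DeltaMap (sub_set hS) (map_set D I) := @MkDeltaMap (sub_set hS) (map_set D I)
    (fun k y => False_rect _ (no k y)) (fun k l a y => False_rect _ (no l y)).
  have u_ex (Z : C) (t : DeltaMap (sub_set hS) (map_set D Z)) :
      exists h : Hom I Z, forall l y, h ∘ u l y = t l y.
    by have [h _] := initial_ex Z hI; exists h => l y; case: (no l y).
  have u_eq (Z : C) (h h' : Hom I Z) : (forall l y, h ∘ u l y = h' ∘ u l y) -> h = h'.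
    by move=> _; apply: initial_eq.
  by exists (mk_rep u_ex u_eq).
have [P iP] := mk A; have [Q iQ] := mk B; exists P, Q.
exact: (initial_cof hC).
Qed.

(** With the strict inequality this is the [(d-1)]-skeleton of the simplex; it is empty for [d = 0]
    and the whole boundary for [d = n]. *)
Lemma cof_on_skeleton d : d <= n -> cof_on_sub (fun k (y : simplex n k) => k < d).
Proof.
elim: d => [|d IH] dn; first exact: cof_on_empty.
(* The finitely many [d]-cells are attached one at a time along a list; a cell that already occurs
   in the tail changes nothing. *)
have step (s : seq (Delta_hom d n)) : cof_on_sub (fun k (y : simplex n k) =>
    k < d \/ exists2 x, x \in s & existT (simplex n) k y = existT (simplex n) d x).
  elim: s => [|x s IHs].
    suff -> : (fun k (y : simplex n k) => k < d \/ exists2 x, x \in [::]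
        & existT (simplex n) k y = existT (simplex n) d x)
        = (fun k (y : simplex n k) => is_true (k < d)) by apply: IH; apply: ltnW.
    apply: functional_extensionality_dep => k; apply/funext => y; apply/propext.
    by split=> [[//|[x]]|]; [rewrite in_nil | left].
  have [xs|xs] := boolP (x \in s).
    suff -> : (fun k (y : simplex n k) => k < d \/ exists2 x0, x0 \in x :: s
        & existT (simplex n) k y = existT (simplex n) d x0)
        = (fun k (y : simplex n k) => k < d \/ exists2 x, x \in s
           & existT (simplex n) k y = existT (simplex n) d x) by [].
    apply: functional_extensionality_dep => k; apply/funext => y; apply/propext.
    split=> [[|[z]]|[|[z]]]; try by left.
      by rewrite in_cons => /orP[/eqP ->|zs] e; right; [exists x | exists z].
    by move=> zs e; right; exists z; rewrite // in_cons zs orbT.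
  suff -> : (fun k (y : simplex n k) => k < d \/ exists2 x0, x0 \in x :: s
        & existT (simplex n) k y = existT (simplex n) d x0)
      = @attach (simplex n) (fun k (y : simplex n k) => k < d \/ exists2 x, x \in s
        & existT (simplex n) k y = existT (simplex n) d x) d x.
    apply: cof_on_attach => //.
      case=> [|[z zs e]]; first by rewrite ltnn.
      by move: xs; rewrite (existT_inj e) zs.
    move=> l a na; left; rewrite ltn_neqAle (Delta_hom_leq a) andbT.
    by apply/eqP => e; apply/na/Delta_is_idmE.
  apply: functional_extensionality_dep => k; apply/funext => y; apply/propext.
  split=> [[|[z]]|[[|[z zs e]]|e]].
  - by left; left.
  - by rewrite in_cons => /orP[/eqP ->|zs] e; [right | left; right; exists z].
  - by left.
  - by right; exists z; rewrite // in_cons zs orbT.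
  - by right; exists x; rewrite // in_cons eqxx.
suff -> : (fun k (y : simplex n k) => is_true (k < d.+1))
    = (fun k (y : simplex n k) => k < d \/ exists2 x, x \in enum {: {g : {ffun 'I_d.+1 -> 'I_n.+1} | inj_mono g}}
       & existT (simplex n) k y = existT (simplex n) d x) by apply: step.
apply: functional_extensionality_dep => k; apply/funext => y; apply/propext.
rewrite ltnS leq_eqVlt; split=> [/orP[/eqP e|]|[->|[x _ e]]]; rewrite ?orbT //.
- right; move: y; rewrite e => y; exists y => //; exact: mem_enum.
- by left.
- by have /= -> := congr1 (@projT1 _ _) e; rewrite eqxx.
Qed.

(** The case [d = n] of [cof_on_skeleton]: an arrow into [[n]] is not an identity exactly when its
    source has smaller dimension. *)
Lemma latching_mor_cof :
  exists (P : latching n A) (Q : latching n B), cof (latching_mor f P Q).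
Proof.
have e : (fun k (y : simplex n k) => is_true (k < n))
    = (fun k (y : simplex n k) => ~ is_idm y).
  apply: functional_extensionality_dep => k; apply/funext => y; apply/propext.
  rewrite ltn_neqAle (Delta_hom_leq y) andbT.
  by split=> [/eqP h /Delta_is_idmE //|h]; apply/eqP => /Delta_is_idmE.
have := cof_on_skeleton (leqnn n); rewrite e => -[hS].
by rewrite boundary_sub_set.
Qed.

End Cells.

Section CellConsequences.
Variables (C : PreCofCat) (hC : is_cofibration_category C).

(** The identity of [A] is a cofibration in the degrees where [A] is cofibrant, so
    [latching_mor_cof] applies to it and provides the object. *)
Lemma latching_ex n (A : coDelta C) :
  (forall d, d < n -> cofibrant_at d A) -> exists P : latching n A, True.
Proof.
move=> cA; have [|P _] := latching_mor_cof hC (f := idm A) cA; last by exists P.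
by move=> d dn; apply: cof_at_id => //; apply: cA.
Qed.

Lemma latching_mor_cof_any n (A B : coDelta C) (f : Hom A B) (P : latching n A)
    (Q : latching n B) :
  (forall d, d < n -> cofibrant_at d A) -> (forall d, d < n -> cof_at d f) ->
  cof (latching_mor f P Q).
Proof.
move=> cA cf; have [P' [Q' c]] := latching_mor_cof hC cA cf.
rewrite -[f]comp1m (latching_morM _ _ P Q' Q) -[f]compm1 (latching_morM _ _ P P' Q').
apply: (cof_comp hC); last apply: (cof_comp hC) => //; apply: (iso_cof hC);
  by apply: latching_mor_iso => k _; apply: is_iso_id.
Qed.

(** [f n] is a cobase change of the map of latching objects followed by the relative latching
    map. *)
Lemma cofibration_level n (A B : coDelta C) (f : Hom A B) :
  cofibrant A -> is_cofibration f -> cof (f n).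
Proof.
move=> cA cf; have [P [Q [R [a [b [h [po ha hb ch]]]]]]] := cf n.
rewrite -ha; apply: (cof_comp hC) => //.
apply: (po_cof hC (pushout_sym po)); apply: latching_mor_cof_any => d _.
  exact: cA.
exact: cf.
Qed.

End CellConsequences.

Lemma nt_congr (D T : Category) (F G : Functor D T) (s t : NatTrans F G) x :
  s = t -> s x = t x.
Proof. by move=> ->. Qed.

Lemma nt_iso (D T : Category) (F G : FunCat D T) (s : Hom F G) :
  is_iso s -> forall x, is_iso (s x).
Proof.
by move=> [t [ts st]] x; exists (t x); split; [apply: (nt_congr x ts) | apply: (nt_congr x st)].
Qed.

(** * Degreewise pushouts and their latching objects *)

Section LevelwisePushouts.
Variables (D T : Category) (A B E : FunCat D T) (i : Hom A B) (f : Hom A E).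

Lemma nt_comp (F G H : FunCat D T) (g : Hom G H) (h : Hom F G) x :
  (g ∘ h) x = g x ∘ h x.
Proof. by []. Qed.

Lemma levelwise_pushout (P : FunCat D T) (k : Hom B P) (j : Hom E P) :
  (forall x, is_pushout (i x) (f x) (k x) (j x)) -> is_pushout i f k j.
Proof.
move=> po; apply: pushoutI => [|Z b c e|Z h h' ek ej].
- by apply: nt_eq => x; apply: (po_comm (po x)).
- have ex x : b x ∘ i x = c x ∘ f x by rewrite -!nt_comp e.
  pose h x := cid (po_ex (po x) (ex x)).
  have hnat x y (a : Hom x y) : sval (h y) ∘ fhom P a = fhom Z a ∘ sval (h x).
    rewrite /h; case: cid => v /= [vk vj]; case: cid => w /= [wk wj].
    apply: (po_eq (po x)); rewrite -!compA -?(nt_nat k) -?(nt_nat j) ?wk ?wj compA.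
      by rewrite vk nt_nat.
    by rewrite vj nt_nat.
  exists (@MkNatTrans D T P Z (fun x => sval (h x)) hnat).
  by split; apply: nt_eq => x /=; rewrite /h; case: cid => v /= [].
- apply: nt_eq => x; apply: (po_eq (po x)).
    exact: (nt_congr x ek).
  exact: (nt_congr x ej).
Qed.

Lemma levelwise_pushout_ex :
  (forall x, exists (P : T) (k : Hom (B x) P) (j : Hom (E x) P),
     is_pushout (i x) (f x) k j) ->
  exists (P : FunCat D T) (k : Hom B P) (j : Hom E P),
    forall x, is_pushout (i x) (f x) (k x) (j x).
Proof.
move=> ex.
have pick x : exists s : {P : T & (Hom (B x) P * Hom (E x) P)%type},
    is_pushout (i x) (f x) (projT2 s).1 (projT2 s).2.
  by have [P [k [j po]]] := ex x; exists (existT _ P (k, j)).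
pose P x := projT1 (sval (cid (pick x))).
pose k x : Hom (B x) (P x) := (projT2 (sval (cid (pick x)))).1.
pose j x : Hom (E x) (P x) := (projT2 (sval (cid (pick x)))).2.
have po x : is_pushout (i x) (f x) (k x) (j x) := svalP (cid (pick x)).
have hex x y (a : Hom x y) : exists h : Hom (P x) (P y),
    h ∘ k x = k y ∘ fhom B a /\ h ∘ j x = j y ∘ fhom E a.
  apply: (po_ex (po x)); rewrite -!compA -(nt_nat i) -(nt_nat f) !compA.
  by rewrite (po_comm (po y)).
pose h x y (a : Hom x y) := sval (cid (hex x y a)).
have hk x y (a : Hom x y) : h x y a ∘ k x = k y ∘ fhom B a.
  by rewrite /h; case: cid => ? [].
have hj x y (a : Hom x y) : h x y a ∘ j x = j y ∘ fhom E a.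
  by rewrite /h; case: cid => ? [].
have h1 x : h x x (idm x) = idm (P x).
  by apply: (po_eq (po x)); rewrite ?hk ?hj fhom1 compm1 comp1m.
have hM x y z (b : Hom y z) (a : Hom x y) : h x z (b ∘ a) = h y z b ∘ h x y a.
  apply: (po_eq (po x)).
    by rewrite hk fhomM compA -hk -compA -hk compA.
  by rewrite hj fhomM compA -hj -compA -hj compA.
pose PF : FunCat D T := @MkFunctor D T P h h1 hM.
exists PF, (@MkNatTrans D T B PF k (fun x y a => esym (hk x y a))).
by exists (@MkNatTrans D T E PF j (fun x y a => esym (hj x y a))).
Qed.

End LevelwisePushouts.

Lemma const_inj_mono n : inj_mono [ffun _ : 'I_1 => ord0 : 'I_n.+1].
Proof. by apply/inj_monoP; split=> [i j _|i j _]; rewrite ?ffunE // !ord1. Qed.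

Section PushoutLatching.
Variables (C : Category) (A B E P : coDelta C).
Variables (i : Hom A B) (f : Hom A E) (k : Hom B P) (j : Hom E P).
Hypothesis po : forall x : Delta, is_pushout (i x) (f x) (k x) (j x).
Variables (n : nat) (PA : latching n A) (PB : latching n B) (PE : latching n E).
Variables (L : C) (p : Hom PB L) (q : Hom PE L).
Hypothesis poL : is_pushout (latching_mor i PA PB) (latching_mor f PA PE) p q.

(** Colimits commute: a map out of [L] is a pair of families on the boundary with values in maps
    from [B] and [E] that agree on [A], and degreewise such a pair is a family of maps from [P]. So
    [L] itself serves as a latching object of [P]. *)
Lemma latching_pushout : exists PP : latching n P,
  is_pushout (latching_mor i PA PB) (latching_mor f PA PE)
    (latching_mor k PB PP) (latching_mor j PE PP).
Proof.
have e l (y : boundary n l) : p ∘ rep_univ PB l y ∘ i l = q ∘ rep_univ PE l y ∘ f l.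
  rewrite -!compA -(latching_morE i PA) -(latching_morE f PA) !compA; congr (_ ∘ _).
  exact: (po_comm poL).
pose u l (y : boundary n l) := sval (cid (po_ex (po l) (e l y))).
have uk l (y : boundary n l) : u l y ∘ k l = p ∘ rep_univ PB l y.
  by rewrite /u; case: cid => ? [].
have uj l (y : boundary n l) : u l y ∘ j l = q ∘ rep_univ PE l y.
  by rewrite /u; case: cid => ? [].
have unat l m (a : @Hom Delta l m) (y : boundary n m) :
    u l (face (boundary n) a y) = u m y ∘ fhom P a.
  apply: (po_eq (po l)); rewrite -compA -nt_nat compA ?uk ?uj rep_univ_face.
    by rewrite compA.
  by rewrite compA.
pose U := @MkDeltaMap (boundary n) (map_set P L) u unat.
have u_ex (Z : C) (t : DeltaMap (boundary n) (map_set P Z)) :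
    exists h : Hom L Z, forall l y, h ∘ U l y = t l y.
  pose tB := compD (map_set_pre k Z) t; pose tE := compD (map_set_pre j Z) t.
  have te : rep_of PB tB ∘ latching_mor i PA PB = rep_of PE tE ∘ latching_mor f PA PE.
    apply: rep_eq => l y; rewrite -!compA !latching_morE !compA !rep_ofE /=.
    by rewrite -!compA (po_comm (po l)).
  have [h [hp hq]] := po_ex poL te; exists h => l y.
  apply: (po_eq (po l)); rewrite -compA ?uk ?uj compA ?hp ?hq rep_ofE //.
have u_eq (Z : C) (h h' : Hom L Z) :
    (forall l y, h ∘ U l y = h' ∘ U l y) -> h = h'.
  move=> hh; apply: (po_eq poL); apply: rep_eq => l y; rewrite -!compA.
    by rewrite -uk !compA (hh l y).
  by rewrite -uj !compA (hh l y).
exists (mk_rep u_ex u_eq).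
have -> : latching_mor k PB (mk_rep u_ex u_eq) = p.
  by apply: rep_eq => l y; rewrite latching_morE mk_rep_univ; apply: uk.
have -> // : latching_mor j PE (mk_rep u_ex u_eq) = q.
by apply: rep_eq => l y; rewrite latching_morE mk_rep_univ; apply: uj.
Qed.

End PushoutLatching.

Section Cofibrations.
Variables (C : PreCofCat) (hC : is_cofibration_category C).

Lemma cofibration_pushout_ex (A B E : coDelta C) (i : Hom A B) (f : Hom A E) :
  cofibrant A -> is_cofibration i ->
  exists (P : coDelta C) (k : Hom B P) (j : Hom E P),
    forall x : Delta, is_pushout (i x) (f x) (k x) (j x).
Proof.
move=> cA ci; apply: levelwise_pushout_ex => x; apply: (cof_po_ex hC).
exact: cofibration_level.
Qed.

(** The relative latching map [h] of [j] is a cobase change of the relative latching map [m] of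
    [i]. *)
Lemma cofibration_pushout (A B E P : coDelta C) (i : Hom A B) (f : Hom A E)
    (k : Hom B P) (j : Hom E P) :
  (forall x : Delta, is_pushout (i x) (f x) (k x) (j x)) ->
  cofibrant A -> cofibrant E -> is_cofibration i -> is_cofibration j.
Proof.
move=> po cA cE ci n.
have [PA [PB [S [s [t [m [poS ms mt cm]]]]]]] := ci n.
have [PE cPE] := cE n.
have cl : cof (latching_mor i PA PB).
  by apply: (latching_mor_cof_any hC) => d _; [apply: cA | apply: ci].
have [L [p [q poL0]]] := cof_po_ex hC (latching_mor f PA PE) cl.
have [PP poL] := latching_pushout po poL0.
have [R [a [b poR]]] := cof_po_ex hC (latching_mor j PE PP) cPE.
have [h [ha hb]] := po_ex poR (latching_map_nat j PE PP).
exists PE, PP, R, a, b, h; split=> //.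
have po1 := pushout_paste poL (pushout_sym poR).
rewrite -(latching_map_nat f PA PE) in po1.
have e : (b ∘ latching_mor k PB PP) ∘ latching_mor i PA PB = a ∘ f n ∘ latching_map PA.
  by rewrite -[RHS]compA (po_comm po1).
have [v [vt vs]] := po_ex (pushout_sym poS) e.
have po2 : is_pushout s (f n) v a.
  by apply: (pushout_cancel (pushout_sym poS)) => //; rewrite vt.
have po3 : is_pushout m v (k n) h.
  apply: pushout_sym; apply: (pushout_cancel (pushout_sym po2)).
    by rewrite ms ha; apply: pushout_sym.
  apply: (po_eq (pushout_sym poS)); rewrite -!compA.
    by rewrite vt mt compA hb -latching_map_nat.
  by rewrite vs ms compA ha (po_comm (po n)).
exact: (po_cof hC po3).
Qed.

Lemma cofibrant_cofibration (A B : coDelta C) (f : Hom A B) :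
  cofibrant A -> is_cofibration f -> cofibrant B.
Proof. by move=> cA cf n; apply: (cofibrant_at_cof hC (f := f)) => //; apply: cA. Qed.

Lemma homotopically_constant_pushout (A B E P : coDelta C) (i : Hom A B)
    (f : Hom A E) (k : Hom B P) (j : Hom E P) :
  (forall x : Delta, is_pushout (i x) (f x) (k x) (j x)) ->
  cofibrant A -> is_cofibration i ->
  homotopically_constant A -> homotopically_constant B -> homotopically_constant E ->
  homotopically_constant P.
Proof.
move=> po cA ci hA hB hE n m a.
apply: (gluing hC (po n) (po m) _ _ (hA _ _ a) (hB _ _ a) (hE _ _ a)).
- exact: cofibration_level.
- exact: cofibration_level.
- by rewrite nt_nat.
- by rewrite nt_nat.
- by rewrite nt_nat.
- by rewrite nt_nat.
Qed.

Lemma level_weq_hconst (A B : coDelta C) (f : Hom A B) :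
  level_equivalence f -> homotopically_constant B -> homotopically_constant A.
Proof.
move=> wf hB n m a; apply: (weq_cancel_left hC (wf m)).
by rewrite nt_nat; apply: (weq_comp hC) => //; apply: wf.
Qed.

End Cofibrations.

(** * Factorization *)

Section Chains.
Variables (D : Category) (X : nat -> D) (p : forall n, Hom (X n.+1) (X n)).

Lemma leq_neqS (n m : nat) : n <= m.+1 -> n <> m.+1 -> n <= m.
Proof. by rewrite leq_eqVlt ltnS => /orP[/eqP|]. Qed.

Lemma leq0_eq (n : nat) : n <= 0 -> 0 = n.
Proof. by rewrite leqn0 => /eqP. Qed.

(** The composite of the tower maps from stage [m] down to stage [n]. The recursion is on [m], so
    stopping at [n] takes a transport along an equality, which [trans_id] and [trans_S] hide. *)
Fixpoint trans (m n : nat) : n <= m -> Hom (X m) (X n) :=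
  match m return n <= m -> Hom (X m) (X n) with
  | 0 => fun h => eq_rect 0 (fun n => Hom (X 0) (X n)) (idm (X 0)) n (leq0_eq h)
  | m'.+1 => fun h =>
    match @eqP _ n m'.+1 with
    | ReflectT e =>
      eq_rect m'.+1 (fun n => Hom (X m'.+1) (X n)) (idm (X m'.+1)) n (esym e)
    | ReflectF ne => trans (leq_neqS h ne) ∘ p m'
    end
  end.

Lemma trans_id n (h : n <= n) : trans h = idm (X n).
Proof.
case: n h => [|n] h /=; first by rewrite (Prop_irrelevance (leq0_eq h) erefl).
by case: eqP => // e; rewrite (Prop_irrelevance (esym e) erefl).
Qed.

Lemma trans_S n m (h : n <= m.+1) (h' : n <= m) : trans h = trans h' ∘ p m.
Proof.
rewrite /=; case: eqP => [e|ne]; first by exfalso; move: (h'); rewrite e ltnn.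
by rewrite (Prop_irrelevance (leq_neqS h ne) h').
Qed.

Lemma trans_comp k n m (h : k <= n) (h' : n <= m) (h'' : k <= m) :
  trans h ∘ trans h' = trans h''.
Proof.
elim: m n h h' h'' => [|m IH] n h h' h''.
  by case: n h h' => // h h'; rewrite [trans h']trans_id compm1 (Prop_irrelevance h h'').
have [e|ne] := pselect (n = m.+1).
  by case: _ / (esym e) h h' => h h'; rewrite [trans h']trans_id compm1 (Prop_irrelevance h h'').
have nm := leq_neqS h' ne.
by rewrite (trans_S h' nm) (trans_S h'' (leq_trans h nm)) compA (IH n h nm (leq_trans h nm)).
Qed.

End Chains.

(* A tower whose maps [N n.+1 -> N n] change only degree [n] has as its limit the
   diagonal, [N k.+1] in degree [k]. *)
Section Diagonal.
Variables (C : Category) (N : nat -> coDelta C) (p : forall n, Hom (N n.+1) (N n)).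
Hypothesis p_iso : forall n k, k <> n -> is_iso (p n k).

Lemma trans_iso m n (h : n <= m) k :
  (forall j, n <= j < m -> k <> j) -> is_iso (trans p h k).
Proof.
elim: m h => [|m IH] h hk.
  by case: n h hk => // h _; rewrite [trans _ _]trans_id; apply: is_iso_id.
have [e|ne] := pselect (n = m.+1).
  by case: _ / (esym e) h hk => h _; rewrite [trans _ _]trans_id; apply: is_iso_id.
have nm := leq_neqS h ne.
rewrite (trans_S p h nm); apply: is_iso_comp.
  by apply: IH => j /andP[nj jm]; apply: hk; rewrite nj ltnS ltnW.
by apply: p_iso; apply: hk; rewrite nm leqnn.
Qed.

Lemma trans_iso_lt k m (h : k < m) : is_iso (trans p h k).
Proof. by apply: trans_iso => j /andP[kj _] e; move: kj; rewrite e ltnn. Qed.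

Definition diag_ob (k : nat) : C := N k.+1 k.

(** In degree [k] the tower is constant up to isomorphism from stage [k.+1] on. The map climbs to
    stage [maxn m k.+1] by inverting the tower map and then descends to stage [m]; quantifying over
    [h] and [h'] frees later uses from particular proofs of the inequalities. *)
Lemma diag_to_ex k m : exists s : Hom (diag_ob k) (N m k),
  forall (h : k < maxn m k.+1) (h' : m <= maxn m k.+1),
    exists t, trans p h k ∘ t = idm _ /\ s = trans p h' k ∘ t.
Proof.
have h0 : k < maxn m k.+1 by rewrite leq_max leqnn orbT.
have h0' : m <= maxn m k.+1 by rewrite leq_max leqnn.
have [t [_ ht]] := trans_iso_lt h0.
exists (trans p h0' k ∘ t) => h h'; exists t.
by rewrite (Prop_irrelevance h h0) (Prop_irrelevance h' h0').
Qed.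

Definition diag_to k m : Hom (diag_ob k) (N m k) := sval (cid (diag_to_ex k m)).

Lemma diag_toE k m m' (h : m' <= m) : trans p h k ∘ diag_to k m = diag_to k m'.
Proof.
rewrite /diag_to; case: cid => s hs; case: cid => s' hs' /=.
have [h1 h2] : k < maxn m k.+1 /\ m <= maxn m k.+1 by rewrite !leq_max !leqnn orbT.
have [h1' h2'] : k < maxn m' k.+1 /\ m' <= maxn m' k.+1 by rewrite !leq_max !leqnn orbT.
have [t [et ->]] := hs h1 h2; have [t' [et' ->]] := hs' h1' h2'.
have mm : maxn m' k.+1 <= maxn m k.+1 by rewrite geq_max !leq_max h leqnn orbT.
have -> : t' = trans p mm k ∘ t.
  apply: (iso_mono (trans_iso_lt h1')); rewrite et' compA -nt_comp.
  by rewrite (trans_comp p _ _ h1).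
by rewrite !compA -!nt_comp !(trans_comp p _ _ (leq_trans h2' mm)).
Qed.

Lemma diag_to1 k : diag_to k k.+1 = idm _.
Proof.
rewrite /diag_to; case: cid => s hs /=.
have h : k < maxn k.+1 k.+1 by rewrite leq_max leqnn.
by have [t [e ->]] := hs h h.
Qed.

Lemma diag_to_trans k m (h : m <= k.+1) : diag_to k m = trans p h k.
Proof. by rewrite -(diag_toE k h) diag_to1 compm1. Qed.

Lemma diag_to_iso k m : k < m -> is_iso (diag_to k m).
Proof.
move=> h; apply: (is_iso_cancel (trans_iso_lt h)).
by rewrite (diag_toE k h) diag_to1; apply: is_iso_id.
Qed.

Definition diag_hom k l (a : @Hom Delta k l) : Hom (diag_ob k) (diag_ob l) :=
  fhom (N l.+1) a ∘ diag_to k l.+1.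

Lemma diag_to_nat k l m (a : @Hom Delta k l) :
  diag_to l m ∘ diag_hom a = fhom (N m) a ∘ diag_to k m.
Proof.
rewrite /diag_hom; have [h|h] := leqP m l.+1.
  by rewrite (diag_to_trans h) compA (nt_nat (trans p h)) -compA diag_toE.
(* Beyond stage [l.+1] the tower map is an isomorphism in degree [l], so equality may be tested at
   stage [l.+1]. *)
apply: (iso_mono (trans_iso_lt (ltnW h))); rewrite !compA.
rewrite (diag_toE l (ltnW h)) diag_to1 comp1m nt_nat -compA.
by rewrite diag_toE.
Qed.

Lemma diag_hom1 k : diag_hom (idm (k : Delta)) = idm _.
Proof. by rewrite /diag_hom fhom1 comp1m diag_to1. Qed.

Lemma diag_homM k l m (b : @Hom Delta l m) (a : @Hom Delta k l) :
  diag_hom (b ∘ a) = diag_hom b ∘ diag_hom a.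
Proof.
by rewrite {2}/diag_hom -compA diag_to_nat compA /diag_hom fhomM.
Qed.

Definition diag : coDelta C := @MkFunctor Delta C diag_ob diag_hom diag_hom1 diag_homM.

Definition diag_proj m : Hom diag (N m) :=
  @MkNatTrans Delta C diag (N m) (fun k => diag_to k m)
    (fun k l a => diag_to_nat m a).

Variables (A : coDelta C) (g : forall n, Hom A (N n)).
Hypothesis pg : forall n, p n ∘ g n.+1 = g n.

Lemma trans_g m n (h : n <= m) : trans p h ∘ g m = g n.
Proof.
elim: m h => [|m IH] h; first by case: n h => // h; rewrite [trans _ _]trans_id comp1m.
have [e|ne] := pselect (n = m.+1).
  by case: _ / (esym e) h => h; rewrite [trans _ _]trans_id comp1m.
by rewrite (trans_S p h (leq_neqS h ne)) -compA pg IH.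
Qed.

Lemma diag_to_g k m : diag_to k m ∘ g k.+1 k = g m k.
Proof.
have [h|h] := leqP m k.+1; first by rewrite (diag_to_trans h) -nt_comp trans_g.
apply: (iso_mono (trans_iso_lt (ltnW h))).
by rewrite compA diag_toE diag_to1 comp1m -nt_comp trans_g.
Qed.

Lemma diag_in_nat k l (a : @Hom Delta k l) :
  g l.+1 l ∘ fhom A a = diag_hom a ∘ g k.+1 k.
Proof. by rewrite /diag_hom -compA diag_to_g nt_nat. Qed.

Definition diag_in : Hom A diag :=
  @MkNatTrans Delta C A diag (fun k => g k.+1 k) diag_in_nat.

Lemma diag_proj_in m : diag_proj m ∘ diag_in = g m.
Proof. by apply: nt_eq => k; apply: diag_to_g. Qed.

End Diagonal.

Section Replacement.
Variables (C : Category) (A N : coDelta C) (g : Hom A N).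

(* An object to put in degree [k] of [N], still under [A^k] and the [k]-th latching
   object and over [N^k]. *)
Record piece (k : nat) := MkPiece {
  piece_ob : C;
  piece_pr : Hom piece_ob (N k);
  piece_in : Hom (A k) piece_ob;
  piece_face : forall j, @Hom Delta j k -> j < k -> Hom (N j) piece_ob;
  piece_pr_in : piece_pr ∘ piece_in = g k;
  piece_pr_face : forall j (a : @Hom Delta j k) h, piece_pr ∘ piece_face a h = fhom N a;
  piece_in_nat : forall j (a : @Hom Delta j k) h,
    piece_in ∘ fhom A a = piece_face a h ∘ g j;
  piece_faceM : forall i j (a : @Hom Delta j k) (b : @Hom Delta i j) h h',
    piece_face (a ∘ b) h = piece_face a h' ∘ fhom N b
}.
Arguments piece_pr {k} p.
Arguments piece_in {k} p.
Arguments piece_face {k} p {j} a h.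

Variable r : forall k, piece k.

Lemma Delta_hom_lt k l (a : @Hom Delta k l) : k <> l -> k < l.
Proof. by move=> ne; rewrite ltn_neqAle (Delta_hom_leq a) andbT; apply/eqP. Qed.

(** Every endomorphism in [Delta] is an identity. Any other arrow strictly raises the dimension and
    is made to pass through [N k], so functoriality reduces to [piece_pr_face] and [piece_faceM]. *)
Definition replace_hom k l (a : @Hom Delta k l) : Hom (piece_ob (r k)) (piece_ob (r l)) :=
  match @eqP _ k l with
  | ReflectT e => eq_rect k (fun l => Hom (piece_ob (r k)) (piece_ob (r l))) (idm _) l e
  | ReflectF ne => piece_face (r l) a (Delta_hom_lt a ne) ∘ piece_pr (r k)
  end.

Lemma replace_homE k (a : @Hom Delta k k) : replace_hom a = idm _.
Proof.
rewrite /replace_hom; case: eqP => // e.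
by rewrite (Prop_irrelevance e erefl).
Qed.

Lemma replace_hom_lt k l (a : @Hom Delta k l) (h : k < l) :
  replace_hom a = piece_face (r l) a h ∘ piece_pr (r k).
Proof.
rewrite /replace_hom; case: eqP => [e|ne]; first by exfalso; move: (h); rewrite e ltnn.
by rewrite (Prop_irrelevance (Delta_hom_lt a ne) h).
Qed.

Lemma replace_pr k l (a : @Hom Delta k l) :
  piece_pr (r l) ∘ replace_hom a = fhom N a ∘ piece_pr (r k).
Proof.
have [e|ne] := pselect (k = l).
  case: _ / e a => a; rewrite replace_homE compm1.
  by rewrite (Delta_endo a) fhom1 comp1m.
by rewrite (replace_hom_lt a (Delta_hom_lt a ne)) compA piece_pr_face.
Qed.

Lemma replace_homM k l m (b : @Hom Delta l m) (a : @Hom Delta k l) :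
  replace_hom (b ∘ a) = replace_hom b ∘ replace_hom a.
Proof.
have [e|ne] := pselect (l = m).
  case: _ / e b => b; rewrite replace_homE comp1m.
  by rewrite (Delta_endo b) comp1m.
have lm := Delta_hom_lt b ne; have km := leq_ltn_trans (Delta_hom_leq a) lm.
rewrite (replace_hom_lt (b ∘ a) km) (replace_hom_lt b lm) -compA replace_pr compA.
by rewrite (piece_faceM _ _ _ _ lm).
Qed.

Definition replace : coDelta C :=
  @MkFunctor Delta C (fun k => piece_ob (r k)) replace_hom
    (fun k => replace_homE (idm (k : Delta))) replace_homM.

Definition replace_proj : Hom replace N :=
  @MkNatTrans Delta C replace N (fun k => piece_pr (r k)) replace_pr.

Lemma replace_in_nat k l (a : @Hom Delta k l) :
  piece_in (r l) ∘ fhom A a = replace_hom a ∘ piece_in (r k).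
Proof.
have [e|ne] := pselect (k = l).
  case: _ / e a => a; rewrite replace_homE comp1m.
  by rewrite (Delta_endo a) fhom1 compm1.
rewrite (replace_hom_lt a (Delta_hom_lt a ne)) -compA piece_pr_in.
exact: piece_in_nat.
Qed.

Definition replace_in : Hom A replace :=
  @MkNatTrans Delta C A replace (fun k => piece_in (r k)) replace_in_nat.

Lemma replace_proj_in : replace_proj ∘ replace_in = g.
Proof. by apply: nt_eq => k; apply: piece_pr_in. Qed.

Definition const_piece k : piece k :=
  @MkPiece k (N k) (idm _) (g k) (fun j a _ => fhom N a) (comp1m _)
    (fun j a _ => comp1m _) (fun j a _ => nt_nat g a)
    (fun i j a b _ _ => fhomM N a b).

End Replacement.

Section Factorization.
Variables (C : PreCofCat) (hC : is_cofibration_category C).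
Variables (A : coDelta C) (cA : cofibrant A).

(** [cof_at n] sees the target only in degrees up to [n], so it survives the replacement of a higher
    degree. *)
Lemma cof_at_lift_iso n (N N' : coDelta C) (g' : Hom A N') (q : Hom N' N) :
  (forall k, k <= n -> is_iso (q k)) -> cof_at n (q ∘ g') -> cof_at n g'.
Proof.
move=> qi [P [Q [R [a [b [h [po ha hb ch]]]]]]].
have [v [vq qv]] := qi n (leqnn n).
apply: (cof_at_transfer (g := q) (h := v ∘ h) _ po).
- by move=> k kn; apply: qi; apply: ltnW.
- by rewrite -compA ha /= compA vq comp1m.
- move=> k y; rewrite -(compA v) hb -(compA v) latching_mapE.
  by rewrite -compA -nt_nat compA vq comp1m.
- by apply: (cof_comp hC) => //; apply: (iso_cof hC); exists (q n).
Qed.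

(** Only degree [n] is repaired: the relative latching map [m] is factored as a cofibration into [Y]
    and a weak equivalence, and [Y] takes the place of [N n]. Being cofibrant below [n], the object
    [N] has the latching object that this requires. *)
Lemma factor_step n (N : coDelta C) (g : Hom A N) :
  (forall k, k < n -> cof_at k g) ->
  exists (N' : coDelta C) (g' : Hom A N') (q : Hom N' N),
    [/\ q ∘ g' = g, forall k, k <> n -> is_iso (q k), weq (q n) &
        forall k, k < n.+1 -> cof_at k g'].
Proof.
move=> cg.
have [P cP] := cA n.
have [Q _] : exists Q : latching n N, True.
  apply: (latching_ex hC) => d dn.
  by apply: (cofibrant_at_cof hC (f := g)); [apply: cA | apply: cg].
have [R [a [b po]]] := cof_po_ex hC (latching_mor g P Q) cP.
have [m [ma mb]] := po_ex po (latching_map_nat g P Q).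
have [Y [h [v [ch wv mE]]]] := factorization hC m.
(* [Y] enters the family of pieces only through the proposition [k = n]. What is needed about it is
   therefore stated for every [k] and recovered at [n] after the choice of [r]. *)
pose good k (r : piece g k) := exists (P : latching k A) (Q : latching k N) (R : C)
    (a : Hom (A k) R) (b : Hom (rep_ob Q) R) (h : Hom R (piece_ob r)),
  [/\ is_pushout (latching_map P) (latching_mor g P Q) a b, h ∘ a = piece_in r,
      forall j (y : boundary k j),
        h ∘ b ∘ rep_univ Q j y = piece_face r (sval y) (boundary_lt y),
      cof h & weq (piece_pr r)].
have nid j (c : @Hom Delta j n) (hj : j < n) : ~ is_idm c.
  by move=> /Delta_is_idmE e; move: hj; rewrite e ltnn.
(* Arrows into the new degree [n] come from the latching object of [N], which maps to [Y] through
   [h ∘ b]. *)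
pose face j (c : @Hom Delta j n) (hj : j < n) : Hom (N j) Y :=
  h ∘ b ∘ rep_univ Q j (exist _ c (nid j c hj) : boundary n j).
have ex k : exists r : piece g k, (k <> n -> is_iso (piece_pr r)) /\ (k = n -> good k r).
  have [->|ne] := pselect (k = n); last first.
    by exists (const_piece g k); split=> // _; apply: is_iso_id.
  have e1 : v ∘ (h ∘ a) = g n by rewrite compA -mE.
  have e2 j (c : @Hom Delta j n) hj : v ∘ face j c hj = fhom N c.
    by rewrite /face !compA -mE mb latching_mapE.
  have e3 j (c : @Hom Delta j n) hj : h ∘ a ∘ fhom A c = face j c hj ∘ g j.
    have /= <- := latching_mapE P (exist _ c (nid j c hj) : boundary n j).
    rewrite /face -!compA; congr (h ∘ _); rewrite compA (po_comm po) -compA.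
    by rewrite latching_morE.
  have e4 i j (c : @Hom Delta j n) (d : @Hom Delta i j) hi hj :
      face i (c ∘ d) hi = face j c hj ∘ fhom N d.
    rewrite /face -!compA; congr (h ∘ (b ∘ _)); rewrite -rep_univ_face.
    by congr (rep_univ Q i _); apply: eq_exist.
  exists (MkPiece e1 e2 e3 e4); split=> // _; exists P, Q, R, a, b, h; split=> // j y /=.
  by rewrite /face; congr (_ ∘ rep_univ Q j _); case: y => y ny; apply: eq_exist.
pose r k := sval (cid (ex k)).
have ri k : k <> n -> is_iso (piece_pr (r k)) by rewrite /r; case: cid => s /= [].
have rg : good n (r n) by rewrite /r; case: cid => s /= [_]; apply.
have [P' [Q' [R' [a' [b' [h' [po' ha' hb' ch' wv']]]]]]] := rg.
exists (replace r), (replace_in r), (replace_proj r); split=> //.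
  exact: replace_proj_in.
move=> k; rewrite ltnS leq_eqVlt => /orP[/eqP ->|kn].
  rewrite -(replace_proj_in r) in po'.
  (* [N] and [replace r] agree below degree [n], so the latching data of [N] serve for the new
     object. *)
  apply: (cof_at_transfer (g := replace_proj r) _ po' ha') => // [j jn|j y].
    by apply: ri => e; move: jn; rewrite e ltnn.
  by rewrite hb' /= (replace_hom_lt _ _ (boundary_lt y)).
apply: (cof_at_lift_iso (q := replace_proj r)); last first.
  by rewrite replace_proj_in; apply: cg.
move=> j jk; apply: ri => e; move: (leq_ltn_trans jk kn).
by rewrite e ltnn.
Qed.

Variables (M : coDelta C) (f : Hom A M).

Definition stage n := {s : {N : coDelta C & Hom A N} | forall k, k < n -> cof_at k (projT2 s)}.

Definition stage_rel n (s : stage n) (t : stage n.+1)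
    (q : Hom (projT1 (sval t)) (projT1 (sval s))) : Prop :=
  [/\ q ∘ projT2 (sval t) = projT2 (sval s), forall k, k <> n -> is_iso (q k) & weq (q n)].

(** The next stage and its map to the present one are packed together, so that a single choice
    yields both the tower and its transition maps. *)
Lemma stage_next n (s : stage n) :
  exists t : {t : stage n.+1 & Hom (projT1 (sval t)) (projT1 (sval s))},
    stage_rel (projT2 t).
Proof.
have [N' [g' [q [e qi wq cg']]]] := factor_step (svalP s).
pose t : stage n.+1 := exist _ (existT _ N' g') cg'.
by exists (existT (fun t : stage n.+1 => Hom (projT1 (sval t)) (projT1 (sval s))) t q).
Qed.

Definition stage0 : stage 0 := exist _ (existT _ M f) (fun k (h : k < 0) => match notF h with end).

Fixpoint stages n : stage n :=
  match n with
  | 0 => stage0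
  | n'.+1 => projT1 (sval (cid (stage_next (stages n'))))
  end.

Lemma reedy_factorization : exists (B : coDelta C) (i : Hom A B) (p : Hom B M),
  [/\ is_cofibration i, level_equivalence p & f = p ∘ i].
Proof.
pose N n := projT1 (sval (stages n)); pose g n : Hom A (N n) := projT2 (sval (stages n)).
pose p n : Hom (N n.+1) (N n) := projT2 (sval (cid (stage_next (stages n)))).
have pP n : stage_rel (p n) := svalP (cid (stage_next (stages n))).
have p_iso n k : k <> n -> is_iso (p n k) by case: (pP n) => _ h _; apply: h.
have pg n : p n ∘ g n.+1 = g n by case: (pP n).
have cg n : cof_at n (g n.+1) by apply: (svalP (stages n.+1)).
exists (diag p_iso), (diag_in p_iso pg), (diag_proj p_iso 0); split.
(* Degree [n] is final from stage [n.+1] on, and the diagonal agrees with that stage in all degrees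
   up to [n]. *)
- move=> n; have [P [Q [R [a [b [h [po ha hb ch]]]]]]] := cg n.
  rewrite -(diag_proj_in p_iso pg) in po.
  apply: (cof_at_transfer (g := diag_proj p_iso n.+1) _ po ha) => // [k kn|k y].
    by apply: diag_to_iso; apply: ltnW.
  by rewrite hb latching_mapE.
(* In degree [k] the projection to [M] is the composite of [p k], a weak equivalence there, with
   maps [p j], [j < k], which are isomorphisms there. *)
- move=> k /=; rewrite (diag_to_trans p_iso (leq0n k.+1)) (trans_S p _ (leq0n k)).
  apply: (weq_comp hC); first by case: (pP k).
  apply: (iso_weq hC); apply: trans_iso => // j /andP[_ jk] e.
  by move: jk; rewrite e ltnn.
- exact: (esym (diag_proj_in p_iso pg 0)).
Qed.

End Factorization.

(** * The cofibration category of frames *)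

Program Definition const_functor (D C : Category) (X : C) : FunCat D C :=
  @MkFunctor D C (fun _ => X) (fun _ _ _ => idm X) _ _.
Next Obligation. by []. Qed.
Next Obligation. by move=> *; rewrite comp1m. Qed.

Section FramesAsCofibrationCategory.
Variables (C : PreCofCat) (hC : is_cofibration_category C).

Lemma const_initial_frame (I : C) : is_initial I -> is_frame (const_functor Delta I).
Proof.
move=> hI; split=> [n|n m a]; last exact: weq_id.
pose u : DeltaMap (boundary n) (map_set (const_functor Delta I) I) :=
  @MkDeltaMap (boundary n) (map_set (const_functor Delta I) I) (fun _ _ => idm I)
    (fun _ _ _ _ => esym (comp1m (idm I))).
have u_ex (Z : C) (t : DeltaMap (boundary n) (map_set (const_functor Delta I) Z)) :
    exists h : Hom I Z, forall k (y : boundary n k), h ∘ u k y = t k y.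
  by have [h _] := initial_ex Z hI; exists h => k y; apply: initial_eq.
have u_eq (Z : C) (h h' : Hom I Z) :
    (forall k (y : boundary n k), h ∘ u k y = h' ∘ u k y) -> h = h'.
  by move=> _; apply: initial_eq.
by exists (mk_rep u_ex u_eq); apply: (initial_cof hC).
Qed.

Lemma const_initial (D : Category) (I : C) :
  is_initial I -> is_initial (const_functor D I).
Proof.
move=> hI F; pose t x := cid (initial_ex (F x) hI).
have tnat (x y : D) (a : Hom x y) :
    sval (t y) ∘ fhom (const_functor D I) a = fhom F a ∘ sval (t x).
  exact: initial_eq.
exists (@MkNatTrans D C (const_functor D I) F (fun x => sval (t x)) tnat).
by split=> // s _; apply: nt_eq => x; apply: initial_eq.
Qed.

(** Initial frames are unique up to isomorphism, and the constant frame on an initial object of [C]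
    is one that is degreewise initial. *)
Lemma frames_initial_level (I : frames C) :
  is_initial I -> forall k : Delta, is_initial (sval I k).
Proof.
move=> hI k; have [J hJ] := has_initial hC.
pose cJ : frames C := exist _ _ (const_initial_frame hJ).
have [f _] := initial_ex cJ hI.
have [g _] := initial_ex (sval I) (const_initial (D := Delta) hJ).
have gf : g ∘ f = idm (sval I) := initial_eq (_ : @Hom (frames C) I I) _ hI.
apply: (iso_initial (f := g k)) => //; exists (f k); split; first exact: initial_eq.
by have := congr1 (fun t => nt t k) gf.
Qed.

Lemma frames_pushout (A B E : frames C) (i : Hom A B) (f : Hom A E) : cof i ->
  exists (P : frames C) (k : Hom B P) (j : Hom E P),
    (forall x : Delta, is_pushout (nt i x) (nt f x) (nt k x) (nt j x)) /\ cof j.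
Proof.
case: A i f => A [cA hA]; case: B => B [cB hB]; case: E => E [cE hE] /= i f ci.
have [P [k [j po]]] := cofibration_pushout_ex hC f cA ci.
have cj := cofibration_pushout hC po cA cE ci.
have fP : is_frame P.
  split; first exact: (cofibrant_cofibration hC cE cj).
  exact: (homotopically_constant_pushout hC po cA ci).
by exists (exist _ P fP), k, j.
Qed.

Lemma frames_pushoutP (A B E P : frames C) (i : Hom A B) (f : Hom A E)
    (k : Hom B P) (j : Hom E P) :
  @is_pushout (coDelta C) _ _ _ _ i f k j -> is_pushout i f k j.
Proof. by case=> e un; split=> // Z b c; apply: un. Qed.

Lemma frames_cofibration_category : is_cofibration_category (frames C).
Proof.
split.
- move=> A B f fi n; apply: (cof_at_iso hC); last exact: (svalP B).1.
  by move=> k _; apply: (nt_iso fi).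
- by move=> A B f fi n; apply: (iso_weq hC); apply: (nt_iso fi).
- by move=> A B B' g f cg cf n; apply: (cof_at_comp hC ((svalP A).1 n) (cf n) (cg n)).
- have [I hI] := has_initial hC; exists (exist _ _ (const_initial_frame hI)) => A.
  exact: const_initial.
- move=> I A f hI n.
  exact: (cof_at_initial f (frames_initial_level hI) ((svalP I).1 n) ((svalP A).1 n)).
- by move=> A B B' g f wf wg n; apply: (weq_comp hC (wf n) (wg n)).
- by move=> A B B' g f wf wgf n; apply: (weq_cancel_right hC (wf n) (wgf n)).
- by move=> A B B' g f wg wgf n; apply: (weq_cancel_left hC (wg n) (wgf n)).
- move=> A B B' i f ci; have [P [k [j [po cj]]]] := frames_pushout f ci.
  exists P, k, j; split=> //.
    by apply: frames_pushoutP; apply: levelwise_pushout.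
  move=> wi n; apply: (po_acof hC (po n)); last exact: wi.
  by apply: cofibration_level => //; apply: (svalP A).1.
- case=> A [cA hA] [B [cB hB]] /= f.
  have [M [i [p [ci wp e]]]] := reedy_factorization hC cA f.
  have fM : is_frame M.
    split; first exact: (cofibrant_cofibration hC cA ci).
    exact: (level_weq_hconst hC wp hB).
  by exists (exist _ M fM), i, p.
Qed.

Lemma eval0_exact : is_exact (eval0 C).
Proof.
split.
- by move=> I hI; apply: frames_initial_level.
- by move=> A B f cf; apply: cofibration_level => //; apply: (svalP A).1.
- by move=> A B f; apply.
- move=> A B B' P i f k j ci po.
  (* The given square is universal among frames only; it is compared with the degreewise pushout,
     which evaluation visibly preserves. *)
  have [P' [k' [j' [po' _]]]] := frames_pushout f ci.
  have [h [ih hk hj]] := po_unique po (frames_pushoutP (levelwise_pushout po')).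
  apply: (pushout_along_iso (h := nt h 0) (po' 0)).
  + exact: (nt_iso ih).
  + exact: (nt_congr _ hk).
  + exact: (nt_congr _ hj).
Qed.

End FramesAsCofibrationCategory.

(** * The derived functor of evaluation *)

Section Decalage.

(** The join of the identity of a point with [a]: the new least vertex is fixed, and [a] acts on the
    others. *)
Definition cone_fun n m (a : Delta_hom n m) : {ffun 'I_n.+2 -> 'I_m.+2} :=
  [ffun i => oapp (fun j => lift ord0 (val a j)) ord0 (unlift ord0 i)].

Lemma cone_fun0 n m (a : Delta_hom n m) : cone_fun a ord0 = ord0.
Proof. by rewrite ffunE unlift_none. Qed.

Lemma cone_fun_lift n m (a : Delta_hom n m) j :
  cone_fun a (lift ord0 j) = lift ord0 (val a j).
Proof. by rewrite ffunE liftK. Qed.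

Lemma cone_fun_inj_mono n m (a : Delta_hom n m) : inj_mono (cone_fun a).
Proof.
have /inj_monoP[inja ma] := valP a; apply/inj_monoP; split=> i j.
  case: (unliftP ord0 i) => [i' ->|->]; case: (unliftP ord0 j) => [j' ->|->];
    rewrite ?cone_fun0 ?cone_fun_lift //.
  by move/lift_inj/inja ->.
case: (unliftP ord0 i) => [i' ->|->]; case: (unliftP ord0 j) => [j' ->|->];
  rewrite ?cone_fun0 ?cone_fun_lift //.
by rewrite /= /bump !leq0n !add1n !ltnS; apply: ma.
Qed.

Definition cone n m (a : @Hom Delta n m) : @Hom Delta n.+1 m.+1 :=
  exist _ (cone_fun a) (cone_fun_inj_mono a).

Lemma coface_inj_mono n : inj_mono [ffun i : 'I_n.+1 => lift (ord0 : 'I_n.+2) i].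
Proof.
apply/inj_monoP; split=> i j; rewrite !ffunE; first exact: lift_inj.
by rewrite /= /bump !leq0n !add1n ltnS.
Qed.

Definition coface n : @Hom Delta n n.+1 :=
  exist _ [ffun i => lift ord0 i] (coface_inj_mono n).

Definition vertex n : @Hom Delta 0 n :=
  exist _ [ffun _ => ord0] (const_inj_mono n).

Lemma cone1 n : cone (idm (n : Delta)) = idm (n.+1 : Delta).
Proof.
apply/val_inj/ffunP => i; case: (unliftP ord0 i) => [j ->|->] /=.
  by rewrite cone_fun_lift /= !ffunE.
by rewrite cone_fun0 ffunE.
Qed.

Lemma coneM n m p (b : @Hom Delta m p) (a : @Hom Delta n m) :
  cone (b ∘ a) = cone b ∘ cone a.
Proof.
apply/val_inj/ffunP => i; rewrite [RHS]ffunE.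
case: (unliftP ord0 i) => [j ->|->] /=; last by rewrite !cone_fun0.
by rewrite !cone_fun_lift /= ffunE.
Qed.

Lemma cone_coface n m (a : @Hom Delta n m) : coface m ∘ a = cone a ∘ coface n.
Proof. by apply/val_inj/ffunP => i; rewrite !ffunE liftK. Qed.

Lemma cone_vertex n m (a : @Hom Delta n m) : cone a ∘ vertex n.+1 = vertex m.+1.
Proof. by apply/val_inj/ffunP => i; rewrite !ffunE unlift_none. Qed.

Variable C : Category.

Program Definition dec (A : coDelta C) : coDelta C :=
  @MkFunctor Delta C (fun n => A n.+1) (fun n m a => fhom A (cone a)) _ _.
Next Obligation. by move=> A n; exact: etrans (congr1 _ (cone1 n)) (fhom1 A _). Qed.
Next Obligation. by move=> A n m p b a; exact: etrans (congr1 _ (coneM b a)) (fhomM A _ _). Qed.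

Definition dec_map (A B : coDelta C) (f : Hom A B) : Hom (dec A) (dec B) :=
  @MkNatTrans Delta C (dec A) (dec B) (fun n => f n.+1)
    (fun n m a => nt_nat f (cone a)).

Program Definition to_dec (A : coDelta C) : Hom A (dec A) :=
  @MkNatTrans Delta C A (dec A) (fun n => fhom A (coface n)) _.
Next Obligation. by move=> A n m a; rewrite /= -!fhomM cone_coface. Qed.

(** Inclusion of the adjoined vertex; it is natural because every [cone a] fixes that vertex. *)
Program Definition const_to_dec (A : coDelta C) : Hom (const_functor Delta (A 0)) (dec A) :=
  @MkNatTrans Delta C (const_functor Delta (A 0)) (dec A) (fun n => fhom A (vertex n.+1)) _.
Next Obligation. by move=> A n m a; rewrite /= compm1 -fhomM cone_vertex. Qed.

Program Definition const_map (X Y : C) (f : Hom X Y) :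
    Hom (const_functor Delta X) (const_functor Delta Y) :=
  @MkNatTrans Delta C (const_functor Delta X) (const_functor Delta Y) (fun _ => f) _.
Next Obligation. by move=> X Y f n m a; rewrite /= comp1m compm1. Qed.

Lemma to_dec_nat (A B : coDelta C) (f : Hom A B) : to_dec B ∘ f = dec_map f ∘ to_dec A.
Proof. by apply: nt_eq => n; rewrite /= nt_nat. Qed.

Lemma const_to_dec_nat (A B : coDelta C) (f : Hom A B) :
  const_to_dec B ∘ const_map (f 0) = dec_map f ∘ const_to_dec A.
Proof. by apply: nt_eq => n; rewrite /= nt_nat. Qed.

End Decalage.

Section LocalizationLemmas.
Variables (C : Category) (W : forall A B : C, Hom A B -> Prop) (D : Category).

Lemma loc_ext_fhom (F : Functor C D) (hF : inverts W F) (A B : C) (f : Hom A B) :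
  fhom (loc_ext hF) (fhom (loc_functor W) f) = fhom F f.
Proof. by rewrite /= (zz_eval_rel _ (zz_repr_class _)) /= compm1. Qed.

(** Every arrow of the localization is a composite of images of arrows and inverses of such images,
    and a naturality square for an invertible arrow yields the one for its inverse. *)
Lemma loc_nat (F G : Functor (Loc W) D) (s : forall A : Loc W, Hom (F A) (G A)) :
  (forall (A B : C) (f : Hom A B),
     s B ∘ fhom F (fhom (loc_functor W) f) = fhom G (fhom (loc_functor W) f) ∘ s A) ->
  forall (A B : Loc W) (c : Hom A B), s B ∘ fhom F c = fhom G c ∘ s A.
Proof.
move=> hs A B c; rewrite -[c]zz_reprK.
elim: (zz_repr c) => {B c} [|B B' f p IH|B B' w hw p IH].
- by rewrite (fhom1 F A : _ = _) (fhom1 G A : _ = _) comp1m compm1.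
- pose c : @Hom (Loc W) A B := zz_class p.
  pose v : @Hom (Loc W) B B' := fhom (loc_functor W) f.
  have -> : zz_class (zz_fwd f p) = v ∘ c by rewrite /v /c /= loc_compE.
  have {}IH : s B ∘ fhom F c = fhom G c ∘ s A := IH.
  have e : s B' ∘ fhom F v = fhom G v ∘ s B := hs B B' f.
  by rewrite !fhomM compA e -compA IH compA.
- pose c : @Hom (Loc W) A B := zz_class p.
  pose v : @Hom (Loc W) B B' := zz_class (zz_bwd hw (zz_id W B)).
  have -> : zz_class (zz_bwd hw p) = v ∘ c by rewrite /v /c /= loc_compE.
  have {}IH : s B ∘ fhom F c = fhom G c ∘ s A := IH.
  pose w' : @Hom (Loc W) B' B := fhom (loc_functor W) w.
  have [vw wv] : v ∘ w' = idm (B' : Loc W) /\ w' ∘ v = idm (B : Loc W).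
    exact: loc_functor_bwd.
  have e : s B' ∘ fhom F v = fhom G v ∘ s B.
    have ew : s B ∘ fhom F w' = fhom G w' ∘ s B' := hs B' B w.
    rewrite -[LHS]comp1m -(fhom1 G) -vw fhomM -!compA (compA (fhom G w')) -ew.
    by rewrite -compA -fhomM wv fhom1 compm1.
  by rewrite !fhomM compA e -compA IH compA.
Qed.

End LocalizationLemmas.

(** * Fractions over a co-Delta-object and the inverse functor *)

Section Equivalence.
Variables (C : PreCofCat) (hC : is_cofibration_category C).

Lemma frames_compE (A B D : frames C) (h : Hom B D) (f : Hom A B) :
  h ∘ f = @comp (coDelta C) (sval A) (sval B) (sval D) h f.
Proof. by []. Qed.

Lemma level_equivalence_cancel (A B M : coDelta C) (q : Hom B M) (v : Hom A B) :
  level_equivalence q -> level_equivalence (q ∘ v) -> level_equivalence v.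
Proof. by move=> wq wqv n; apply: (weq_cancel_left hC (wq n) (wqv n)). Qed.

Lemma frame_factorization (A : frames C) (M : coDelta C) (f : Hom (sval A) M) :
  homotopically_constant M ->
  exists (B : frames C) (i : Hom A B) (p : Hom (sval B) M),
    [/\ cof i, level_equivalence p & f = p ∘ i].
Proof.
case: A f => A [cA hA] /= f hM.
have [B [i [p [ci wp e]]]] := reedy_factorization hC cA f.
have fB : is_frame B.
  split; first exact: (cofibrant_cofibration hC cA ci).
  exact: (level_weq_hconst hC wp hM).
by exists (exist _ B fB), i, p.
Qed.

(** The coproduct is formed degreewise, so its universal property holds against all co-Delta-objects
    [M]; constant objects and decalages are the targets in mind. *)
Lemma frame_coproduct (A A' : frames C) : exists (S : frames C) (a : Hom A S) (a' : Hom A' S),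
  [/\ cof a', forall (M : coDelta C) (f : Hom (sval A) M) (g : Hom (sval A') M),
        exists h : Hom (sval S) M, h ∘ a = f /\ h ∘ a' = g &
      forall (M : coDelta C) (h h' : Hom (sval S) M),
        h ∘ a = h' ∘ a -> h ∘ a' = h' ∘ a' -> h = h'].
Proof.
have hF := frames_cofibration_category hC.
have [I hI] := has_initial hC.
pose J : frames C := exist _ _ (const_initial_frame hC hI).
have hJ := const_initial (D := Delta) hI.
have [i _] := initial_ex (sval A) hJ; have [i' _] := initial_ex (sval A') hJ.
have ci : @cof (frames C) J A i by apply: (initial_cof hF) => B; apply: hJ.
have [S [a [a' [po ca']]]] := frames_pushout hC (i' : @Hom (frames C) J A') ci.
have {}po := levelwise_pushout po.
exists S, a, a'; split=> // [M f g|M h h'].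
  by apply: (po_ex po); apply: initial_eq.
exact: (po_eq po).
Qed.

Definition hmor (A B : frames C) (f : Hom A B) : @Hom (Ho (frames C)) A B :=
  fhom (gamma (frames C)) f.

Lemma hmor1 (A : frames C) : hmor (idm A) = idm (A : Ho (frames C)).
Proof. exact: (fhom1 (gamma (frames C)) A). Qed.

Lemma hmorM (A B D : frames C) (h : Hom B D) (f : Hom A B) :
  hmor (h ∘ f) = hmor h ∘ hmor f.
Proof. exact: (fhomM (gamma (frames C)) h f). Qed.

Lemma hmor_iso (A B : frames C) (f : Hom A B) : level_equivalence f -> is_iso (hmor f).
Proof. by move=> wf; apply: loc_functor_inverts. Qed.

(* If [p'] is a level equivalence, [alpha] plays the role of [p'^-1 p], although [M]
   need not be a frame. *)
Definition lifts (A A' : frames C) (M : coDelta C) (p : Hom (sval A) M)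
    (p' : Hom (sval A') M) (alpha : @Hom (Ho (frames C)) A A') : Prop :=
  exists (B : frames C) (u : Hom A B) (v : Hom A' B) (q : Hom (sval B) M),
    [/\ level_equivalence q, q ∘ u = p, q ∘ v = p' & hmor v ∘ alpha = hmor u].

Section Comparison.
Variables (A A' : frames C) (M : coDelta C).
Variables (p : Hom (sval A) M) (p' : Hom (sval A') M).
Hypothesis hM : homotopically_constant M.

(* Any [u1 : A -> B1 <- A' : v1] over [M] is compared with [u, v] by pushing out along
   the cofibration [A + A' -> B] and factoring the result over [M]. *)
Lemma lifts_universal : exists (B : frames C) (u : Hom A B) (v : Hom A' B)
    (q : Hom (sval B) M),
  [/\ level_equivalence q, q ∘ u = p, q ∘ v = p', cof v &
      forall alpha, lifts p p' alpha -> hmor v ∘ alpha = hmor u].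
Proof.
have hF := frames_cofibration_category hC.
have [S [a [a' [ca' Sex Seq]]]] := frame_coproduct A A'.
have [s [sa sa']] := Sex M p p'.
have [B [w [q [cw wq e]]]] := frame_factorization s hM.
exists B, (w ∘ a), (w ∘ a'), q; split.
- done.
- by rewrite -sa e frames_compE compA.
- by rewrite -sa' e frames_compE compA.
- exact: (cof_comp hF).
move=> alpha [B1 [u [v [q1 [wq1 qu qv e1]]]]].
have [t [ta ta']] := Sex (sval B1) u v.
have [Q [k [j [po _]]]] := frames_pushout hC (t : @Hom (frames C) S B1) cw.
have {}po := levelwise_pushout po.
have eq : q ∘ w = q1 ∘ t.
  by apply: Seq; rewrite -e -compA ?ta ?ta' ?sa ?sa' ?qu ?qv.
have [r [rk rj]] := po_ex po eq.
have [B2 [i [q2 [_ wq2 e2]]]] := frame_factorization r hM.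
pose x : @Hom (frames C) B B2 := i ∘ k; pose y : @Hom (frames C) B1 B2 := i ∘ j.
have wx : level_equivalence x.
  apply: (level_equivalence_cancel wq2).
  by rewrite /x frames_compE compA -e2 rk.
have xa : x ∘ (w ∘ a) = y ∘ u.
  by rewrite /x /y -ta !frames_compE !compA (comp_eqr2 _ (po_comm po)).
have xa' : x ∘ (w ∘ a') = y ∘ v.
  by rewrite /x /y -ta' !frames_compE !compA (comp_eqr2 _ (po_comm po)).
apply: (iso_mono (hmor_iso wx)).
by rewrite compA -hmorM xa' -hmorM xa !hmorM -compA e1.
Qed.

Lemma lifts_ex : level_equivalence p' -> exists alpha, lifts p p' alpha.
Proof.
move=> wp'; have [B [u [v [q [wq qu qv _ _]]]]] := lifts_universal.
have wv : level_equivalence v by apply: (level_equivalence_cancel wq); rewrite qv.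
have [w [wv1 vw1]] := hmor_iso wv.
by exists (w ∘ hmor u), B, u, v, q; split; rewrite // compA vw1 comp1m.
Qed.

(** The universal [u] and [v] do not depend on the lift, and [hmor v] is invertible, so every lift
    is the inverse of [hmor v] composed with [hmor u]. *)
Lemma lifts_eq alpha beta :
  level_equivalence p' -> lifts p p' alpha -> lifts p p' beta -> alpha = beta.
Proof.
move=> wp' la lb; have [B [u [v [q [wq qu qv _ univ]]]]] := lifts_universal.
have wv : level_equivalence v by apply: (level_equivalence_cancel wq); rewrite qv.
by apply: (iso_mono (hmor_iso wv)); rewrite !univ.
Qed.

End Comparison.

(** For [alpha] the universal cospan is taken since its leg [v] is a cofibration; the two cospans
    can then be pushed out along [A'], and the resulting map to [N] is factored to get a frame level
    equivalent to [N]. *)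
Lemma lifts_comp (A A' A'' : frames C) (M N : coDelta C) (h : Hom M N)
    (p : Hom (sval A) M) (p' : Hom (sval A') M) (p'' : Hom (sval A'') N) alpha beta :
  homotopically_constant M -> homotopically_constant N ->
  lifts p p' alpha -> lifts (h ∘ p') p'' beta -> lifts (h ∘ p) p'' (beta ∘ alpha).
Proof.
move=> hM hN la [B2 [u2 [v2 [q2 [wq2 qu2 qv2 e2]]]]].
have [B [u [v [q [wq qu qv cv univ]]]]] := lifts_universal p p' hM.
have [Q [k [j [po _]]]] := frames_pushout hC u2 cv.
have {}po := levelwise_pushout po.
have eq : h ∘ q ∘ v = q2 ∘ u2 by rewrite -compA qv qu2.
have [r [rk rj]] := po_ex po eq.
have [B3 [i [q3 [_ wq3 e3]]]] := frame_factorization r hN.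
pose x : @Hom (frames C) B B3 := i ∘ k; pose y : @Hom (frames C) B2 B3 := i ∘ j.
have xy : x ∘ v = y ∘ u2.
  by rewrite /x /y !frames_compE (comp_eqr2 _ (po_comm po)).
exists B3, (x ∘ u), (y ∘ v2), q3; split=> //.
- by rewrite /x !frames_compE !compA -e3 rk -compA qu.
- by rewrite /y !frames_compE !compA -e3 rj.
- rewrite (hmorM y v2) (hmorM x u) !compA (comp_eqr _ e2) -(hmorM y u2) -xy.
  by rewrite (hmorM x v) -compA univ.
Qed.

Lemma lifts_id (A : frames C) (M : coDelta C) (p : Hom (sval A) M) :
  level_equivalence p -> lifts p p (idm (A : Ho (frames C))).
Proof.
move=> wp; exists A, (idm A), (idm A), p; split=> //; first exact: compm1.
  exact: compm1.
by rewrite compm1.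
Qed.

Lemma lifts_gamma (A A' : frames C) (M : coDelta C) (f : Hom A A')
    (p' : Hom (sval A') M) : level_equivalence p' -> lifts (p' ∘ f) p' (hmor f).
Proof.
move=> wp; exists A', f, (idm A'), p'; split=> //; first exact: compm1.
by rewrite hmor1 comp1m.
Qed.

(** A lift in the opposite direction is the inverse: each composite lifts the same pair as the
    identity, and [lifts_eq] applies. *)
Lemma lifts_iso (A A' : frames C) (M : coDelta C) (p : Hom (sval A) M)
    (p' : Hom (sval A') M) alpha :
  homotopically_constant M -> level_equivalence p -> level_equivalence p' ->
  lifts p p' alpha -> is_iso alpha.
Proof.
move=> hM wp wp' la; have [beta lb] := lifts_ex p' hM wp; exists beta; split.
  apply: (lifts_eq hM wp _ (lifts_id wp)).
  rewrite -[X in lifts X]comp1m; apply: lifts_comp la _ => //.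
  by rewrite comp1m.
apply: (lifts_eq hM wp' _ (lifts_id wp')).
rewrite -[X in lifts X]comp1m; apply: lifts_comp lb _ => //.
by rewrite comp1m.
Qed.

Lemma const_hconst (X : C) : homotopically_constant (const_functor Delta X).
Proof. by move=> n m a; apply: weq_id. Qed.

(** Obtained by factoring the map from the initial frame to the constant object. *)
Lemma frame_replacement_ex (X : C) :
  exists s : {A : frames C & Hom (sval A) (const_functor Delta X)},
    level_equivalence (projT2 s).
Proof.
have [I hI] := has_initial hC.
pose J : frames C := exist _ _ (const_initial_frame hC hI).
have [f _] := initial_ex (const_functor Delta X) (const_initial (D := Delta) hI).
have [B [_ [p [_ wp _]]]] := frame_factorization (f : Hom (sval J) _) (const_hconst X).
by exists (existT _ B p).
Qed.

Definition frame_of (X : C) : frames C := projT1 (sval (cid (frame_replacement_ex X))).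

Definition frame_aug (X : C) : Hom (sval (frame_of X)) (const_functor Delta X) :=
  projT2 (sval (cid (frame_replacement_ex X))).

Lemma frame_augP (X : C) : level_equivalence (frame_aug X).
Proof. exact: (svalP (cid (frame_replacement_ex X))). Qed.

Definition frame_hom (X Y : C) (f : Hom X Y) :
    @Hom (Ho (frames C)) (frame_of X) (frame_of Y) :=
  sval (cid (lifts_ex (const_map f ∘ frame_aug X) (const_hconst Y) (frame_augP Y))).

Lemma frame_homP (X Y : C) (f : Hom X Y) :
  lifts (const_map f ∘ frame_aug X) (frame_aug Y) (frame_hom f).
Proof. exact: svalP. Qed.

Lemma frame_homE (X Y : C) (f : Hom X Y) alpha :
  lifts (const_map f ∘ frame_aug X) (frame_aug Y) alpha -> frame_hom f = alpha.
Proof. by apply: (lifts_eq (const_hconst Y) (frame_augP Y)); apply: frame_homP. Qed.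

Lemma frame_hom1 (X : C) : frame_hom (idm X) = idm (frame_of X : Ho (frames C)).
Proof.
apply: frame_homE; have -> : const_map (idm X) ∘ frame_aug X = frame_aug X.
  by apply: nt_eq => n /=; rewrite comp1m.
exact: (lifts_id (frame_augP X)).
Qed.

Lemma frame_homM (X Y Z : C) (h : Hom Y Z) (f : Hom X Y) :
  frame_hom (h ∘ f) = frame_hom h ∘ frame_hom f.
Proof.
apply: frame_homE.
have -> : const_map (h ∘ f) ∘ frame_aug X = const_map h ∘ (const_map f ∘ frame_aug X).
  by apply: nt_eq => n /=; rewrite compA.
apply: (lifts_comp (const_hconst Y) (const_hconst Z)); exact: frame_homP.
Qed.

Definition frame_functor : Functor C (Ho (frames C)) :=
  @MkFunctor C (Ho (frames C)) frame_of frame_hom frame_hom1 frame_homM.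

Lemma frame_functor_inverts : inverts (@weq C) frame_functor.
Proof.
move=> X Y f wf; apply: (lifts_iso (const_hconst Y) _ (frame_augP Y) (frame_homP f)).
by move=> n; apply: (weq_comp hC _ wf); apply: frame_augP.
Qed.

Definition inverse_functor : Functor (Ho C) (Ho (frames C)) :=
  loc_ext frame_functor_inverts.

Definition Ho_eval0 : Functor (Ho (frames C)) (Ho C) := derived_functor (eval0_exact hC).

Lemma Ho_eval0E (A B : frames C) (f : Hom A B) :
  fhom Ho_eval0 (hmor f) = fhom (gamma C) (nt f 0).
Proof. exact: loc_ext_fhom. Qed.

(** In degree [0] the auxiliary maps [p], [p'] and [q] are honest morphisms of [C], so the equation
    of a fraction, stated for [alpha] only through the frame [B], holds literally in the homotopy
    category of [C]. *)
Lemma lifts_eval0 (A A' : frames C) (M : coDelta C) (p : Hom (sval A) M)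
    (p' : Hom (sval A') M) alpha : lifts p p' alpha ->
  fhom (gamma C) (p' 0) ∘ fhom Ho_eval0 alpha = fhom (gamma C) (p 0).
Proof.
move=> [B [u [v [q [_ <- <- e]]]]].
rewrite -!/(nt_comp _ _ _) !nt_comp !fhomM -compA -!Ho_eval0E -fhomM.
by rewrite e.
Qed.

Lemma unit_ex (A : frames C) :
  exists alpha, lifts (const_to_dec (sval A) ∘ frame_aug (fob (sval A) 0)) (to_dec (sval A)) alpha.
Proof.
apply: lifts_ex => [n m a|n]; exact: (svalP A).2.
Qed.

Definition unit_hom (A : frames C) : @Hom (Ho (frames C)) (frame_of (fob (sval A) 0)) A :=
  sval (cid (unit_ex A)).

Lemma unit_homP (A : frames C) :
  lifts (const_to_dec (sval A) ∘ frame_aug (fob (sval A) 0)) (to_dec (sval A)) (unit_hom A).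
Proof. exact: svalP. Qed.

Lemma unit_hom_iso (A : frames C) : is_iso (unit_hom A).
Proof.
apply: (lifts_iso _ _ _ (unit_homP A)) => [n m a|n|n]; try exact: (svalP A).2.
by apply: (weq_comp hC); [apply: frame_augP | apply: (svalP A).2].
Qed.

(** Both sides lift the same map [sval (frame_of _) -> dec (sval B)] along [to_dec (sval B)]. The
    naturality of [const_to_dec] handles the left side, that of [to_dec] the right side. *)
Lemma unit_hom_nat (A B : frames C) (f : Hom A B) :
  unit_hom B ∘ frame_hom (nt f 0) = hmor f ∘ unit_hom A.
Proof.
have hD (D : frames C) : homotopically_constant (dec (sval D)).
  by move=> n m a; apply: (svalP D).2.
have wB : level_equivalence (to_dec (sval B)) by move=> n; apply: (svalP B).2.
apply: (lifts_eq (p := dec_map f ∘ (const_to_dec (sval A) ∘ frame_aug _)) (hD B) wB).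
  rewrite compA -const_to_dec_nat -compA.
  exact: (lifts_comp (const_hconst _) (hD B) (frame_homP _) (unit_homP B)).
apply: (lifts_comp (hD A) (hD B) (unit_homP A)).
by rewrite -to_dec_nat; apply: lifts_gamma.
Qed.

Lemma Ho_eval0_equivalence : is_equivalence Ho_eval0.
Proof.
exists inverse_functor; split.
  have unat : forall (A B : Ho (frames C)) (c : Hom A B),
      (unit_hom B : @Hom (Ho (frames C)) _ _) ∘ fhom (compF inverse_functor Ho_eval0) c
      = fhom (idF (Ho (frames C))) c ∘ unit_hom A.
    apply: (@loc_nat _ _ _ (compF inverse_functor Ho_eval0) (idF _) unit_hom) => A B f.
    change (unit_hom B ∘ fhom inverse_functor (fhom Ho_eval0 (hmor f)) = hmor f ∘ unit_hom A).
    by rewrite Ho_eval0E [fhom inverse_functor _]loc_ext_fhom unit_hom_nat.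
  exists (@MkNatTrans _ _ (compF inverse_functor Ho_eval0) (idF _) unit_hom unat) => A.
  exact: unit_hom_iso.
(* The counit is the augmentation of the chosen frame in degree [0], a weak equivalence; its
   naturality is [lifts_eval0] applied to [frame_homP]. *)
pose s (X : Ho C) : @Hom (Ho C) (sval (frame_of X) 0) X := fhom (gamma C) (frame_aug X 0).
have snat : forall (X Y : Ho C) (c : Hom X Y),
    s Y ∘ fhom (compF Ho_eval0 inverse_functor) c = fhom (idF (Ho C)) c ∘ s X.
  apply: (@loc_nat _ _ _ (compF Ho_eval0 inverse_functor) (idF _) s) => X Y f.
  change (s Y ∘ fhom Ho_eval0 (fhom inverse_functor (fhom (gamma C) f))
          = fhom (gamma C) f ∘ s X).
  rewrite [fhom inverse_functor _]loc_ext_fhom /s (lifts_eval0 (frame_homP f)).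
  exact: (fhomM (gamma C) f (frame_aug X 0)).
exists (@MkNatTrans _ _ (compF Ho_eval0 inverse_functor) (idF _) s snat) => X.
by apply: loc_functor_inverts; apply: frame_augP.
Qed.

End Equivalence.

Theorem theorem6p10 (C : PreCofCat) (hC : is_cofibration_category C) :
  is_cofibration_category (frames C) /\
  exists ex : is_exact (eval0 C), is_equivalence (derived_functor ex).
Proof.
split; first exact: frames_cofibration_category.
by exists (eval0_exact hC); apply: Ho_eval0_equivalence.
Qed.
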